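(* Let $A$ be a discrete $p$-primary abelian group endowed with the trivial $G$-action, and let $\vartheta:\Gamma\to\mathbb{Z}_p^\times$ be a continuous character. Then there is a canonical equivalence $$R\Gamma(G,A(\vartheta))\simeq R\Gamma\bigl(\Gamma,\mathbb{X}(A)\{\vartheta\}\bigr)$$ in $D^+(\mathrm{Mod}_p^{\mathrm{disc}})$. In particular, for every integer $m$, $$R\Gamma(G,A(m))\simeq R\Gamma\bigl(\Gamma,\mathbb{X}(A)\{m\}\bigr)\simeq \mathrm{CD}_m(\mathbb{X}(A)).$$
   Context: Let $p$ be an odd prime, $S=\{p,\infty\}$, $\mathbb{Q}_S$ the maximal extension of $\mathbb{Q}$ unramified outside $S$, $G=\mathrm{Gal}(\mathbb{Q}_S/\mathbb{Q})$, $F_\infty=\mathbb{Q}(\mu_{p^\infty})=\bigcup_n\mathbb{Q}(\mu_{p^n})$, $H=\mathrm{Gal}(\mathbb{Q}_S/F_\infty)$, and $\Gamma=G/H=\mathrm{Gal}(F_\infty/\mathbb{Q})$. Let $\chi_\Gamma:\Gamma\xrightarrow{\sim}\mathbb{Z}_p^\times$ be the isomorphism induced by the cyclotomic character. For a profinite group $K$, $\mathrm{Mod}_{K,p}^{\mathrm{disc}}$ is the abelian category of discrete $p$-primary abelian groups with continuous $K$-action, and $D^+(\mathrm{Mod}_{K,p}^{\mathrm{disc}})$ is its bounded-below derived $\infty$-category (realized by bounded-below complexes of injectives); for $K=1$ write $\mathrm{Mod}_p^{\mathrm{disc}}$. For a closed normal subgroup $K'$ of $K$, $R\Gamma(K',-):D^+(\mathrm{Mod}_{K,p}^{\mathrm{disc}})\to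 D^+(\mathrm{Mod}_{K/K',p}^{\mathrm{disc}})$ is the right derived functor of $K'$-invariants $(-)^{K'}:\mathrm{Mod}_{K,p}^{\mathrm{disc}}\to\mathrm{Mod}_{K/K',p}^{\mathrm{disc}}$. Twists: for a continuous character $\vartheta:\Gamma\to\mathbb{Z}_p^\times$ and $M\in\mathrm{Mod}_{\Gamma,p}^{\mathrm{disc}}$, $M\{\vartheta\}$ is the same abelian group with $\delta\in\Gamma$ acting by $\vartheta(\delta)$ times its original action. For $M\in\mathrm{Mod}_{G,p}^{\mathrm{disc}}$, $M(\vartheta)$ is the same abelian group with $g\in G$ acting by $\vartheta(\bar g)$ times its original action, $\bar g$ being the image of $g$ in $\Gamma$. These are exact autoequivalences and extend degreewise to complexes and to the derived $\infty$-categories. For an integer $m$, $(m):=(\chi_\Gamma^m)$ and $\{m\}:=\{\chi_\Gamma^m\}$ (so $A(m)$ is the usual Tate twist). The universal cyclotomic complex is $\mathbb{X}(A):=R\Gamma(H,A)\in D^+(\mathrm{Mod}_{\Gamma,p}^{\mathrm{disc}})$. For $M^\bullet\in D^+(\mathrm{Mod}_{\Gamma,p}^{\mathrm{disc}})$, the $m$-th cyclotomic descent is $\mathrm{CD}_m(M^\bullet):=R\Gamma(\Gamma,M^\bullet\{m\})\in D^+(\mathrm{Mod}_p^{\mathrm{disc}})$. *)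

(* Defs.v *)
From HB Require Import structures.
From mathcomp Require Import all_boot all_order all_algebra all_field.
From mathcomp Require Import all_classical topology_structure product_topology.
From mathcomp Require Import quotient_topology.

Set Implicit Arguments.
Unset Strict Implicit.
Unset Printing Implicit Defensive.

Import Order.TTheory GRing.Theory Num.Theory.

Local Open Scope classical_set_scope.
Local Open Scope ring_scope.

(* Z_p is the inverse limit of the rings Z/p^(n+1), so that all of them are
   nontrivial rings when p is prime. *)
Definition Zp_seq (p : nat) : Type := forall n : nat, 'Z_(p ^ n.+1).

Section ZpSeq.
Variable p : nat.
Implicit Types u v w : Zp_seq p.

HB.instance Definition _ := gen_eqMixin (Zp_seq p).
HB.instance Definition _ := gen_choiceMixin (Zp_seq p).

Let add u v : Zp_seq p := fun n => u n + v n.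
Let opp u : Zp_seq p := fun n => - u n.
Let zero : Zp_seq p := fun=> 0.
Let mul u v : Zp_seq p := fun n => u n * v n.
Let one : Zp_seq p := fun=> 1.

Let addA : associative add.
Proof. by move=> u v w; apply/functional_extensionality_dep => n; exact: addrA. Qed.
Let addC : commutative add.
Proof. by move=> u v; apply/functional_extensionality_dep => n; exact: addrC. Qed.
Let add0 : left_id zero add.
Proof. by move=> u; apply/functional_extensionality_dep => n; exact: add0r. Qed.
Let addN : left_inverse zero opp add.
Proof. by move=> u; apply/functional_extensionality_dep => n; exact: addNr. Qed.
HB.instance Definition _ := GRing.isZmodule.Build (Zp_seq p) addA addC add0 addN.

Let mulA : associative mul.
Proof. by move=> u v w; apply/functional_extensionality_dep => n; exact: mulrA. Qed.
Let mulC : commutative mul.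
Proof. by move=> u v; apply/functional_extensionality_dep => n; exact: mulrC. Qed.
Let mul1 : left_id one mul.
Proof. by move=> u; apply/functional_extensionality_dep => n; exact: mul1r. Qed.
Let mulD : left_distributive mul +%R.
Proof. by move=> u v w; apply/functional_extensionality_dep => n; exact: mulrDl. Qed.
Let one_neq0 : one != 0.
Proof.
apply/eqP => /(congr1 (fun u : Zp_seq p => u 0%N)) /eqP.
by rewrite (oner_eq0 'Z_(p ^ 1)).
Qed.
HB.instance Definition _ :=
  GRing.Zmodule_isComNzRing.Build (Zp_seq p) mulA mulC mul1 mulD one_neq0.

(* inZp is here the reduction map Z/p^(n+2) -> Z/p^(n+1). *)
Definition Zp_compatible : {pred Zp_seq p} :=
  fun u => `[< forall n, inZp (u n.+1) = u n >].

Let dvd_mod n : ((Zp_trunc (p ^ n.+1)).+2 %| (Zp_trunc (p ^ n.+2)).+2)%N.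
Proof.
have E (m : nat) : (Zp_trunc m).+2 = maxn 2 m.
  by case: m => [|[|m]]; rewrite /Zp_trunc //= /maxn; case: m.
rewrite !E; case: p => [|[|q]]; [by rewrite !exp0n | by rewrite !exp1n |].
have h m : (1 < q.+2 ^ m.+1)%N by rewrite -{1}(exp1n m.+1) ltn_exp2r.
by rewrite (maxn_idPr (h n)) (maxn_idPr (h n.+1)) dvdn_exp2l.
Qed.

Let inZpB n (a b : 'Z_(p ^ n.+2)) :
  inZp (a - b : 'Z_(p ^ n.+2))%R = inZp a - inZp b :> 'Z_(p ^ n.+1).
Proof.
have D (c : 'Z_(p ^ n.+2)) : inZp (c + b : 'Z_(p ^ n.+2))%R = inZp c + inZp b :> 'Z_(p ^ n.+1).
  by apply/val_inj; rewrite /= modn_dvdm ?dvd_mod // modnDm.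
by apply/eqP; rewrite eq_sym subr_eq -D subrK.
Qed.

Let inZpM n (a b : 'Z_(p ^ n.+2)) :
  inZp (a * b : 'Z_(p ^ n.+2))%R = inZp a * inZp b :> 'Z_(p ^ n.+1).
Proof. by apply/val_inj; rewrite /= modn_dvdm ?dvd_mod // modnMm. Qed.

Lemma Zp_compatible_subring : subring_closed Zp_compatible.
Proof.
split.
- by apply/asboolP => n; apply/val_inj.
- by move=> u v /asboolP hu /asboolP hv; apply/asboolP => n; rewrite inZpB hu hv.
- by move=> u v /asboolP hu /asboolP hv; apply/asboolP => n; rewrite inZpM hu hv.
Qed.
HB.instance Definition _ :=
  GRing.isSubringClosed.Build _ Zp_compatible Zp_compatible_subring.

Record padic : Type := MkZp { Zp_val : Zp_seq p; _ : Zp_val \in Zp_compatible }.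

HB.instance Definition _ := [isSub of padic for Zp_val].
HB.instance Definition _ := [Choice of padic by <:].
HB.instance Definition _ := [SubChoice_isSubComNzRing of padic by <:].

Definition Zp_unit : {pred padic} := fun u : padic => `[< exists v : padic, v * u = 1 >].
Definition Zp_inv (u : padic) : padic :=
  if pselect (exists v : padic, v * u = 1) is left h then projT1 (cid h) else u.
Let Zp_mulVx : {in Zp_unit, left_inverse 1 Zp_inv *%R}.
Proof.
move=> u /asboolP hu; rewrite /Zp_inv; case: pselect => // h.
exact: (projT2 (cid h)).
Qed.
Let Zp_unitP (u v : padic) : v * u = 1 -> Zp_unit u.
Proof. by move=> h; apply/asboolP; exists v. Qed.
Let Zp_inv_out : {in [predC Zp_unit], Zp_inv =1 id}.
Proof.
move=> u /asboolP hu; rewrite /Zp_inv; case: pselect => // h.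
Qed.
HB.instance Definition _ :=
  GRing.ComNzRing_hasMulInverse.Build padic Zp_mulVx Zp_unitP Zp_inv_out.

(* The residue of u modulo p^(n+1). *)
Definition Zp_res (u : padic) : forall n, 'Z_(p ^ n.+1) := Zp_val u.
Coercion Zp_res : padic >-> Funclass.

(* The p-adic topology: congruence modulo powers of p. *)
Definition Zp_open : set_system padic :=
  [set U : set padic | forall u : padic, U u -> exists n, forall v : padic, v n = u n -> U v].
Lemma Zp_resE n m (u : padic) : (n <= m)%N -> u n = inZp (u m).
Proof.
have dvd k : (n <= k)%N ->
    ((Zp_trunc (p ^ n.+1)).+2 %| (Zp_trunc (p ^ k.+1)).+2)%N.
  elim: k => [|k IH]; first by rewrite leqn0 => /eqP ->.
  rewrite leq_eqVlt => /orP[/eqP -> //|].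
  by rewrite ltnS => /IH h; exact: dvdn_trans h (dvd_mod _).
elim: m => [|m IH]; first by rewrite leqn0 => /eqP ->; apply/val_inj; rewrite /= modZp.
rewrite leq_eqVlt => /orP[/eqP ->|]; first by apply/val_inj; rewrite /= modZp.
rewrite ltnS => nm; rewrite IH //.
have /asboolP/(_ m) E := valP u; rewrite [u m](esym E).
by apply/val_inj; rewrite /= modn_dvdm // dvd.
Qed.
Let Zp_openT : Zp_open setT.
Proof. by move=> u _; exists 0%N. Qed.
Let Zp_openI : setI_closed Zp_open.
Proof.
move=> U V hU hV u [/hU [n hn] /hV [m hm]]; exists (maxn n m) => v e; split.
  by apply: hn; rewrite !(@Zp_resE n (maxn n m)) ?leq_maxl // e.
by apply: hm; rewrite !(@Zp_resE m (maxn n m)) ?leq_maxr // e.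
Qed.
Let Zp_open_bigU (I : Type) (f : I -> set padic) :
  (forall i, Zp_open (f i)) -> Zp_open (\bigcup_i f i).
Proof.
by move=> h u [i _ /(h i) [n hn]]; exists n => v /hn fv; exists i.
Qed.
HB.instance Definition _ :=
  isOpenTopological.Build padic Zp_openT Zp_openI Zp_open_bigU.

End ZpSeq.

HB.mixin Record isTopGroup G of Group G & Topological G := {
  mulg_continuous : continuous (fun x : G * G => (x.1 * x.2)%g);
  invg_continuous : continuous (fun x : G => (x^-1)%g)
}.
#[short(type="topGroupType")]
HB.structure Definition TopGroup :=
  {G of Group G & Topological G & isTopGroup G}.

Definition trivial_group : Type := unit.
HB.instance Definition _ := Choice.on trivial_group.
Section TrivialGroup.
Let mul (x y : trivial_group) : trivial_group := tt.
Let inv (x : trivial_group) : trivial_group := tt.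
Let tmulA : associative mul. Proof. by []. Qed.
Let tmul1 : left_id tt mul. Proof. by case. Qed.
Let tmulr1 : right_id tt mul. Proof. by case. Qed.
Let tmulV : left_inverse tt inv mul. Proof. by []. Qed.
Let tmulrV : right_inverse tt inv mul. Proof. by []. Qed.
HB.instance Definition _ :=
  isGroup.Build trivial_group tmulA tmul1 tmulr1 tmulV tmulrV.
Let topen : set_system trivial_group := setT.
Let topenI : setI_closed topen. Proof. by []. Qed.
Let topenU (I : Type) (f : I -> set trivial_group) :
  (forall i, topen (f i)) -> topen (\bigcup_i f i). Proof. by []. Qed.
HB.instance Definition _ :=
  isOpenTopological.Build trivial_group (I : topen setT) topenI topenU.
Let tc1 : continuous (fun x : trivial_group * trivial_group => (x.1 * x.2)%g).
Proof. exact: (@cst_continuous _ _ (tt : trivial_group)). Qed.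
Let tc2 : continuous (fun x : trivial_group => (x^-1)%g).
Proof. exact: (@cst_continuous _ _ (tt : trivial_group)). Qed.
HB.instance Definition _ := isTopGroup.Build trivial_group tc1 tc2.
End TrivialGroup.

Lemma nbhs_ex_open (T : topologicalType) (x : T) (U : set T) :
  nbhs x U -> exists O : set T, [/\ open O, O x & O `<=` U].
Proof. by rewrite nbhsE => -[O [oO Ox] OU]; exists O. Qed.

Record closed_normal (K : topGroupType) := ClosedNormal {
  cn_set :> K -> Prop;
  cn1 : cn_set 1%g;
  cnM : forall x y, cn_set x -> cn_set y -> cn_set (x * y)%g;
  cnV : forall x, cn_set x -> cn_set (x^-1)%g;
  cnJ : forall x y, cn_set x -> cn_set (y * x * y^-1)%g;
  cn_closed : closed (cn_set : set K)
}.

Section QuotientGroup.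
Variables (K : topGroupType) (N : closed_normal K).
Implicit Types x y : K.
Local Open Scope quotient_scope.

Definition coset_eq : rel K := fun x y => `[< N (x^-1 * y)%g >].

Let coset_eq_refl : reflexive coset_eq.
Proof. by move=> x; apply/asboolP; rewrite mulVg; exact: cn1. Qed.
Let coset_eq_sym : symmetric coset_eq.
Proof.
have H x y : coset_eq x y -> coset_eq y x.
  by move=> /asboolP /cnV; rewrite invgM invgK => h; apply/asboolP.
by move=> x y; apply/idP/idP; exact: H.
Qed.
Let coset_eq_trans : transitive coset_eq.
Proof.
move=> y x z /asboolP h /asboolP h'; apply/asboolP.
by have := cnM h h'; rewrite -mulgA mulVKg.
Qed.
Definition coset_equiv : equiv_rel K :=
  EquivRel coset_eq coset_eq_refl coset_eq_sym coset_eq_trans.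

Definition quotg : Type := quotient_topology {eq_quot coset_equiv}.

HB.instance Definition _ := Topological.on quotg.
HB.instance Definition _ := Quotient.on quotg.

Definition quotg_pi : K -> quotg := \pi_quotg.

Lemma quotg_piP x y : quotg_pi x = quotg_pi y <-> N (x^-1 * y)%g.
Proof.
split=> [h|h]; first by have /eqmodP/asboolP := h.
by apply/eqmodP/asboolP.
Qed.

Let one : quotg := quotg_pi 1%g.
Let mul (a b : quotg) : quotg := quotg_pi (repr a * repr b)%g.
Let inv (a : quotg) : quotg := quotg_pi (repr a)^-1%g.

Let piK (a : quotg) : quotg_pi (repr a) = a. Proof. exact: reprK. Qed.

Let mulE x y : mul (quotg_pi x) (quotg_pi y) = quotg_pi (x * y)%g.
Proof.
apply/quotg_piP.
have /quotg_piP hx := piK (quotg_pi x).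
have /quotg_piP hy := piK (quotg_pi y).
move: (repr (quotg_pi x)) (repr (quotg_pi y)) hx hy => x' y' hx hy.
have -> : ((x' * y')^-1 * (x * y) =
    (y'^-1 * (x'^-1 * x) * y'^-1^-1) * (y'^-1 * y))%g.
  by rewrite invgM invgK !mulgA mulgK.
exact: cnM (cnJ _ hx) hy.
Qed.
Let invE x : inv (quotg_pi x) = quotg_pi x^-1%g.
Proof.
apply/quotg_piP; have /quotg_piP hx := piK (quotg_pi x).
move: (repr _) hx => x' hx; rewrite invgK.
have -> : (x' * x^-1 = x' * (x'^-1 * x)^-1 * x'^-1)%g.
  by rewrite invgM invgK !mulgA mulgK.
exact: cnJ (cnV hx).
Qed.
Let mulA : associative mul.
Proof. by move=> a b c; rewrite -(piK a) -(piK b) -(piK c) !mulE mulgA. Qed.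
Let mul1 : left_id one mul.
Proof. by move=> a; rewrite -(piK a) mulE mul1g. Qed.
Let mulr1 : right_id one mul.
Proof. by move=> a; rewrite -(piK a) mulE mulg1. Qed.
Let mulV : left_inverse one inv mul.
Proof. by move=> a; rewrite -(piK a) invE mulE mulVg. Qed.
Let mulrV : right_inverse one inv mul.
Proof. by move=> a; rewrite -(piK a) invE mulE mulgV. Qed.
HB.instance Definition _ := isGroup.Build quotg mulA mul1 mulr1 mulV mulrV.

Lemma quotg_piM x y : quotg_pi (x * y)%g = (quotg_pi x * quotg_pi y)%g.
Proof. exact: esym (mulE x y). Qed.
Lemma quotg_pi_surj (a : quotg) : exists x, quotg_pi x = a.
Proof. by exists (repr a). Qed.
Lemma quotg_openE (U : set quotg) : open U <-> open (quotg_pi @^-1` U).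
Proof. by []. Qed.

Let mulrC x : continuous (fun y : K => (y * x)%g).
Proof.
move=> y; apply: (@continuous_comp _ _ _ (fun y => (y, x))
  (fun z : K * K => (z.1 * z.2)%g)); last exact: mulg_continuous.
by apply: cvg_pair => //=; exact: cvg_cst.
Qed.
Let pi_open (V : set K) : open V -> open (quotg_pi @` V).
Proof.
move=> oV; apply/quotg_openE.
rewrite (_ : _ @^-1` _ = \bigcup_(n in N : set K) ((fun y => (y * n)%g) @^-1` V)).
  by apply: bigcup_open => n _; apply: open_comp oV => y _; exact: mulrC.
apply/seteqP; split=> [y [v Vv /quotg_piP h]|y [n Nn Vyn]] /=.
  exists (y^-1 * v)%g; last by rewrite /= mulVKg.
  by have := cnV h; rewrite invgM invgK.
exists (y * n)%g => //; apply/quotg_piP; rewrite invgM -mulgA mulVg mulg1.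
exact: cnV.
Qed.
Let quotg_mulC : continuous (fun a : quotg * quotg => (a.1 * a.2)%g).
Proof.
move=> [a b] U nU; have {nU} : nbhs (a * b)%g U by exact: nU.
move=> /nbhs_ex_open[O [oO Oab OU]].
rewrite -(piK a) -(piK b) -quotg_piM in Oab.
have := @mulg_continuous K (repr a, repr b) (quotg_pi @^-1` O).
case.
  by apply: open_nbhs_nbhs; split => //; apply/quotg_openE.
move=> [V W] /= [/nbhs_ex_open[V' [oV' V'a V'V]] /nbhs_ex_open[W' [oW' W'b W'W]]] VW.
suff : filter_prod (nbhs a) (nbhs b)
    ((fun a : quotg * quotg => (a.1 * a.2)%g) @^-1` U) by exact.
exists (quotg_pi @` V', quotg_pi @` W') => /=.
  split; apply: open_nbhs_nbhs; split; try exact: pi_open.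
    by exists (repr a).
  by exists (repr b).
move=> [c d] /= [[v Vv <-] [w Ww <-]]; rewrite -quotg_piM; apply: OU.
by apply: (VW (v, w)); split; [exact: V'V | exact: W'W].
Qed.
Let quotg_invC : continuous (fun a : quotg => (a^-1)%g).
Proof.
apply/continuousP => U oU; apply/quotg_openE.
rewrite (_ : _ @^-1` _ = (fun x : K => x^-1)%g @^-1` (quotg_pi @^-1` U)).
  apply: open_comp; first by move=> y _; exact: invg_continuous.
  exact/quotg_openE.
by apply/seteqP; split => y /=; rewrite -[(quotg_pi y)^-1%g]/(inv _) invE.
Qed.
HB.instance Definition _ := isTopGroup.Build quotg quotg_mulC quotg_invC.
End QuotientGroup.

(* Such a map identifies Q with K / ker pi as topological groups; it is used for
   G -> G/H and for the maps to the trivial group. *)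
Record quotient_map (K Q : topGroupType) := QuotientMap {
  qm_fun :> K -> Q;
  qmM : forall x y, qm_fun (x * y)%g = (qm_fun x * qm_fun y)%g;
  qm_surj : forall a, exists x, qm_fun x = a;
  qm_open : forall U : set Q, open U <-> open (qm_fun @^-1` U)
}.

Definition quotg_map (K : topGroupType) (N : closed_normal K) :
    quotient_map K (quotg N) :=
  QuotientMap (@quotg_piM K N) (@quotg_pi_surj K N) (@quotg_openE K N).

Section ToTrivial.
Variable K : topGroupType.
Let to1 (_ : K) : trivial_group := tt.
Let to1_surj (a : trivial_group) : exists x, to1 x = a.
Proof. by exists 1%g; case: a. Qed.
Let to1_open (U : set trivial_group) : open U <-> open (to1 @^-1` U).
Proof.
split=> // _; have [Utt|nUtt] := pselect (U tt).
  by rewrite (_ : to1 @^-1` U = setT); [exact: openT | by apply/seteqP; split=> // -[]].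
by rewrite (_ : to1 @^-1` U = set0); [exact: open0 | by apply/seteqP; split].
Qed.
Definition to_trivial : quotient_map K trivial_group :=
  @QuotientMap K trivial_group to1 (fun _ _ => erefl) to1_surj to1_open.
End ToTrivial.

Definition is_subfield (E : fieldType) (F : set E) : Prop :=
  [/\ F 1, forall x y, F x -> F y -> F (x - y)
         & forall x y, F x -> F y -> F (x / y)].

Section FieldAut.
Variable E : fieldType.

Definition is_field_aut (s : E -> E) : Prop :=
  [/\ bijective s, s 1 = 1, {morph s : x y / x + y} & {morph s : x y / x * y}].

Record field_aut : Type := FieldAut {
  aut_fun : E -> E; _ : `[< is_field_aut aut_fun >] }.
Coercion aut_fun : field_aut >-> Funclass.

HB.instance Definition _ := [isSub of field_aut for aut_fun].
HB.instance Definition _ := [Choice of field_aut by <:].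

Implicit Types s t : field_aut.

Lemma field_autP s : is_field_aut s.
Proof. by case: s => s /= /asboolP. Qed.

Lemma field_aut_eq s t : (forall x, s x = t x) -> s = t.
Proof. by move=> h; apply/val_inj/funext. Qed.

Let one_subproof : `[< is_field_aut (id : E -> E) >].
Proof. by apply/asboolP; split => //; exists id. Qed.
Let mul_subproof s t : `[< is_field_aut (s \o t) >].
Proof.
have [bs s1 sD sM] := field_autP s; have [bt t1 tD tM] := field_autP t.
apply/asboolP; split; first exact: bij_comp.
- by rewrite /= t1 s1.
- by move=> x y; rewrite /= tD sD.
- by move=> x y; rewrite /= tM sM.
Qed.
Let inv_ex s : exists t, cancel s t /\ cancel t s.
Proof.
have [[t st ts] s1 sD sM] := field_autP s.
suff Ht : `[< is_field_aut t >] by exists (FieldAut Ht).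
apply/asboolP; split; first by exists s.
- by rewrite -s1 st.
- by move=> x y; apply: (can_inj st); rewrite sD !ts.
- by move=> x y; apply: (can_inj st); rewrite sM !ts.
Qed.

Definition aut_one : field_aut := FieldAut one_subproof.
Definition aut_mul s t : field_aut := FieldAut (mul_subproof s t).
Definition aut_inv s : field_aut := projT1 (cid (inv_ex s)).

Lemma aut_invK s : cancel s (aut_inv s).
Proof. exact: (projT2 (cid (inv_ex s))).1. Qed.
Lemma aut_invVK s : cancel (aut_inv s) s.
Proof. exact: (projT2 (cid (inv_ex s))).2. Qed.

Let amulA : associative aut_mul.
Proof. by move=> s t u; apply: field_aut_eq. Qed.
Let amul1 : left_id aut_one aut_mul.
Proof. by move=> s; apply: field_aut_eq. Qed.
Let amulr1 : right_id aut_one aut_mul.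
Proof. by move=> s; apply: field_aut_eq. Qed.
Let amulV : left_inverse aut_one aut_inv aut_mul.
Proof. by move=> s; apply: field_aut_eq => x; exact: aut_invK. Qed.
Let amulrV : right_inverse aut_one aut_inv aut_mul.
Proof. by move=> s; apply: field_aut_eq => x; exact: aut_invVK. Qed.
HB.instance Definition _ :=
  isGroup.Build field_aut amulA amul1 amulr1 amulV amulrV.

(* A basic neighbourhood of s is s Gal(E/L) with L generated by the finite
   set r. *)
Definition krull_open : set_system field_aut :=
  [set U : set field_aut | forall s, U s ->
    exists r : seq E, forall t, {in r, t =1 s} -> U t].
Let krull_openT : krull_open setT.
Proof. by move=> s _; exists [::]. Qed.
Let krull_openI : setI_closed krull_open.
Proof.
move=> U V hU hV s [/hU [r hr] /hV [q hq]]; exists (r ++ q) => t e; split.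
  by apply: hr => x xr; apply: e; rewrite mem_cat xr.
by apply: hq => x xq; apply: e; rewrite mem_cat xq orbT.
Qed.
Let krull_open_bigU (I : Type) (f : I -> set field_aut) :
  (forall i, krull_open (f i)) -> krull_open (\bigcup_i f i).
Proof. by move=> h s [i _ /(h i) [r hr]]; exists r => t /hr ft; exists i. Qed.
HB.instance Definition _ :=
  isOpenTopological.Build field_aut krull_openT krull_openI krull_open_bigU.

Let nbhs_agree s (r : seq E) : nbhs s [set t : field_aut | {in r, t =1 s}].
Proof.
apply: open_nbhs_nbhs; split => //.
suff : krull_open [set t : field_aut | {in r, t =1 s}] by exact.
by move=> t /= ts; exists r => u ut x xr; rewrite ut // ts.
Qed.
Let aut_mulC : continuous (fun a : field_aut * field_aut => (a.1 * a.2)%g).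
Proof.
move=> [s t] U /nbhs_ex_open[O [oO Ost OU]].
have [r hr] := oO _ Ost.
suff : filter_prod (nbhs s) (nbhs t)
  ((fun a : field_aut * field_aut => (a.1 * a.2)%g) @^-1` U) by exact.
exists ([set s' : field_aut | {in map t r, s' =1 s}],
        [set t' : field_aut | {in r, t' =1 t}]).
  by split; exact: nbhs_agree.
move=> [s' t'] /= [hs ht]; apply/OU/hr => x xr.
by rewrite -[LHS]/(s' (t' x)) -[RHS]/(s (t x)) ht // hs // map_f.
Qed.
Let aut_invC : continuous (fun s : field_aut => (s^-1)%g).
Proof.
move=> s U /nbhs_ex_open[O [oO Os OU]]; have [r hr] := oO _ Os.
suff : nbhs s ((fun s : field_aut => (s^-1)%g) @^-1` U) by exact.
apply: filterS (nbhs_agree s (map (s^-1)%g r)) => t /= ts.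
apply/OU/hr => x xr.
have /(congr1 (t^-1)%g) := ts _ (map_f _ xr).
by rewrite -[(t^-1)%g]/(aut_inv t) -[(s^-1)%g]/(aut_inv s) aut_invK aut_invVK.
Qed.
HB.instance Definition _ := isTopGroup.Build field_aut aut_mulC aut_invC.

(* The subgroup Gal(E/F), for F stable under all automorphisms of E. *)
Section Fixer.
Variables (F : set E) (F_stable : forall s x, F x -> F (s x)).
Let fix_set s : Prop := forall x, F x -> s x = x.
Let fix1 : fix_set 1%g. Proof. by []. Qed.
Let fixM s t : fix_set s -> fix_set t -> fix_set (s * t)%g.
Proof. by move=> hs ht x Fx; rewrite -[LHS]/(s (t x)) ht // hs. Qed.
Let fixV s : fix_set s -> fix_set (s^-1)%g.
Proof. by move=> hs x Fx; rewrite -{1}(hs x Fx); exact: aut_invK. Qed.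
Let fixJ s t : fix_set s -> fix_set (t * s * t^-1)%g.
Proof.
move=> hs x Fx; rewrite -[LHS]/(t (s ((t^-1)%g x))) hs; last exact: F_stable.
exact: aut_invVK.
Qed.
Let fix_closed : closed (fix_set : set field_aut).
Proof.
rewrite -openC; suff : krull_open (~` (fix_set : set field_aut)) by exact.
move=> s /= /existsNP[x /not_implyP[Fx sx]].
exists [:: x] => t ts; apply/existsNP; exists x; apply/not_implyP; split => //.
by rewrite ts ?mem_head.
Qed.
Definition fixer : closed_normal field_aut :=
  ClosedNormal fix1 fixM fixV fixJ fix_closed.
End Fixer.

End FieldAut.

(* Q_S is realized inside algC, the algebraic closure of Q. *)

Definition number_field (K : set algC) : Prop :=
  is_subfield K /\
  exists b : seq algC, forall x, K x ->
    exists c : nat -> rat, x = \sum_(i < size b) ratr (c i) * b`_i.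

(* Prime ideals of the ring of integers of K. *)
Record prime_ideal (K q : set algC) : Prop := PrimeIdeal {
  prime_sub : forall x, q x -> K x /\ x \in Aint;
  prime_0 : q 0;
  prime_add : forall x y, q x -> q y -> q (x + y);
  prime_mul : forall a x, K a -> a \in Aint -> q x -> q (a * x);
  prime_1 : ~ q 1;
  prime_prime : forall x y, K x -> x \in Aint -> K y -> y \in Aint ->
    q (x * y) -> q x \/ q y
}.

Definition ideal_square (q : set algC) : set algC :=
  [set x | exists s : seq (algC * algC),
    (forall ab, ab \in s -> q ab.1 /\ q ab.2) /\
    x = \sum_(ab <- s) ab.1 * ab.2].

(* Every prime q above l has ramification index 1, i.e. q^2 does not divide
   (l); the residue extensions, being finite, are always separable. *)
Definition unramified_at (K : set algC) (l : nat) : Prop :=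
  forall q, prime_ideal K q -> q l%:R -> ~ ideal_square q l%:R.

(* Unramified outside {p, oo}: no condition at the archimedean places. *)
Definition unramified_outside (p : nat) (K : set algC) : Prop :=
  forall l, prime l -> l != p -> unramified_at K l.

(* The compositum of all number fields unramified outside {p, oo}. *)
Definition QS_set (p : nat) : set algC :=
  [set x | forall F : set algC, is_subfield F ->
    (forall K, number_field K -> unramified_outside p K -> K `<=` F) -> F x].

Section QS.
Variable p : nat.

Definition QS_pred : {pred algC} := fun x => `[< QS_set p x >].

Let QS_divring : divring_closed QS_pred.
Proof.
split.
- by apply/asboolP => F [].
- move=> x y /asboolP hx /asboolP hy; apply/asboolP => F hF hK.
  by case: (hF) => _ hB _; apply: hB; [exact: hx | exact: hy].
- move=> x y /asboolP hx /asboolP hy; apply/asboolP => F hF hK.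
  by case: (hF) => _ _ hB; apply: hB; [exact: hx | exact: hy].
Qed.
HB.instance Definition _ :=
  GRing.isDivringClosed.Build _ QS_pred QS_divring.

Record QS : Type := MkQS { QS_val : algC; _ : QS_val \in QS_pred }.
HB.instance Definition _ := [isSub of QS for QS_val].
HB.instance Definition _ := [Choice of QS by <:].
HB.instance Definition _ := [SubChoice_isSubComUnitRing of QS by <:].
HB.instance Definition _ := [SubComUnitRing_isSubIntegralDomain of QS by <:].
HB.instance Definition _ := [SubIntegralDomain_isSubField of QS by <:].

(* Automorphisms fix the prime field, so this is Gal(Q_S/Q). *)
Definition GS : Type := field_aut QS.
HB.instance Definition _ := TopGroup.on GS.

Definition root_p_power (z : QS) : Prop := exists n, z ^+ (p ^ n) = 1.

(* Q(mu_(p^oo)): the cyclotomic fields Q(mu_(p^n)) are unramified outside p, so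
   all p-power roots of unity of algC lie in Q_S. *)
Definition Finf : set QS :=
  [set x | forall F : set QS, is_subfield F ->
    (forall z, root_p_power z -> F z) -> F x].

Lemma Finf_stable (s : GS) (x : QS) : Finf x -> Finf (s x).
Proof.
have [_ s1 sD sM] := field_autP s.
have s0 : s 0 = 0 by apply: (addrI (s 0)); rewrite -sD !addr0.
have sX z n : s (z ^+ n) = s z ^+ n.
  by elim: n => [|n IH]; rewrite ?expr0 // !exprS sM IH.
have sB y z : s (y - z) = s y - s z.
  by apply/eqP; rewrite eq_sym subr_eq -sD subrK.
have sF y z : s (y / z) = s y / s z.
  have [->|z0] := eqVneq z 0; first by rewrite invr0 !mulr0 s0 invr0 mulr0.
  have sz : s z != 0.
    apply/eqP => sz; have /eqP := sM z z^-1.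
    by rewrite sz mul0r mulfV // s1 oner_eq0.
  by apply: (mulIf sz); rewrite -sM !divfK.
move=> Fx F [F1 FB FF] Fz; apply: (Fx (s @^-1` F)).
  split=> [|y z Fy Fz'|y z Fy Fz'] /=; first by rewrite s1.
    by rewrite sB; exact: FB.
  by rewrite sF; exact: FF.
by move=> z [n zn]; apply: Fz; exists n; rewrite -sX zn s1.
Qed.

(* H = Gal(Q_S/F_oo) and Gamma = G/H = Gal(F_oo/Q). *)
Definition HS : closed_normal GS := fixer Finf_stable.

Definition GammaS : Type := quotg HS.
HB.instance Definition _ := TopGroup.on GammaS.

End QS.

Record character (p : nat) (K : topGroupType) := Character {
  char_fun :> K -> padic p;
  char_unit : forall g, char_fun g \is a GRing.unit;
  charM : forall g h, char_fun (g * h)%g = char_fun g * char_fun h;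
  char_continuous : continuous char_fun
}.

Section Characters.
Variable p : nat.

Lemma Zp_res_open n (c : 'Z_(p ^ n.+1)) : open [set u : padic p | u n = c].
Proof.
suff : Zp_open [set u : padic p | u n = c] by exact.
by move=> u /= un; exists n => v vn; rewrite vn.
Qed.

Lemma char_res_open (K : topGroupType) (f : character p K) n
  (c : 'Z_(p ^ n.+1)) : open [set g | f g n = c].
Proof.
have /continuousP/(_ _ (@Zp_res_open n c)) := @char_continuous _ _ f; exact.
Qed.

Lemma char1 (K : topGroupType) (f : character p K) : f 1%g = 1.
Proof.
by apply: (mulIr (char_unit f 1%g)); rewrite -charM mulg1 mul1r.
Qed.

Section Power.
Variables (K : topGroupType) (f : character p K) (m : int).

Let pow_unit g : f g ^ m \is a GRing.unit.
Proof. by case: m => k; rewrite ?unitrV unitrX // char_unit. Qed.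

Let powM g h : f (g * h)%g ^ m = f g ^ m * f h ^ m.
Proof. by rewrite charM exprMz_comm ?char_unit //; exact: mulrC. Qed.

Lemma Zp_resM (u v : padic p) n : (u * v) n = u n * v n. Proof. by []. Qed.
Lemma Zp_res1 n : (1 : padic p) n = 1. Proof. by []. Qed.
Lemma Zp_resX (u : padic p) k n : (u ^+ k) n = u n ^+ k.
Proof. by elim: k => [|k IH]; rewrite ?expr0 // !exprS Zp_resM IH. Qed.

Let pow_continuous : continuous (fun g => f g ^ m).
Proof.
apply/continuousP => U oU; rewrite openE => g /= Ug.
have {oU} : Zp_open U by exact: oU.
move=> /(_ _ Ug)[n hn].
apply: (@filterS _ (nbhs g) _ [set h | f h n = f g n]); last first.
  by apply: open_nbhs_nbhs; split => //; exact: (@char_res_open _ f n).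
move=> h /= e; apply: hn.
have X k : (f h ^+ k) n = (f g ^+ k) n by rewrite !Zp_resX e.
case: m => k; rewrite -?exprnP ?NegzE ?exprnN; first exact: X.
have ug := unitrX k.+1 (char_unit f g); have uh := unitrX k.+1 (char_unit f h).
have Eg : (f g ^- k.+1) n * (f g ^+ k.+1) n = 1.
  by rewrite -Zp_resM mulVr.
have Eh : (f h ^+ k.+1) n * (f h ^- k.+1) n = 1.
  by rewrite -Zp_resM mulrV.
rewrite X in Eh.
have := congr1 (fun c => (f g ^- k.+1) n * c) Eh.
by rewrite mulrA Eg mul1r mulr1.
Qed.

Definition charX : character p K := Character pow_unit powM pow_continuous.
End Power.

Section Pullback.
Variables (K Q : topGroupType) (f : character p Q) (pi : quotient_map K Q).
Let pb_unit g : f (pi g) \is a GRing.unit. Proof. exact: char_unit. Qed.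
Let pbM g h : f (pi (g * h)%g) = f (pi g) * f (pi h).
Proof. by rewrite qmM charM. Qed.
Let pb_continuous : continuous (fun g => f (pi g)).
Proof.
apply/continuousP => U oU; rewrite -[X in open X]/(pi @^-1` (f @^-1` U)).
have /continuousP/(_ _ oU) oV := @char_continuous _ _ f.
exact: (iffLR (qm_open pi (f @^-1` U)) oV).
Qed.
Definition char_pullback : character p K := Character pb_unit pbM pb_continuous.
End Pullback.

End Characters.

Definition is_cyclotomic (p : nat) (chi : character p (GammaS p)) : Prop :=
  forall (g : GS p) (n : nat) (z : QS p), z ^+ (p ^ n.+1) = 1 ->
    g z = z ^+ (chi (quotg_pi (HS p) g) n).

Definition p_primary (p : nat) (M : zmodType) : Prop :=
  forall x : M, exists n, x *+ (p ^ n) = 0.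

Section ZpAction.
Variables (p : nat) (p_pr : prime p) (M : zmodType) (hM : p_primary p M).
Implicit Types (u v : padic p) (x y : M).

Let hMb x : exists n, x *+ (p ^ n.+1) == 0.
Proof. by have [n hn] := hM x; exists n; rewrite expnSr mulrnA hn mul0rn. Qed.

(* u acts on x through its residue modulo any power of p that kills x, see
   zactE below. *)
Definition zact u x : M := x *+ u (ex_minn (hMb x)).

Let mulrn_mod n x k : x *+ (p ^ n.+1) = 0 ->
  x *+ (k %% (Zp_trunc (p ^ n.+1)).+2) = x *+ k.
Proof.
move=> hx; rewrite Zp_cast; last first.
  by rewrite -{1}(exp1n n.+1) ltn_exp2r // prime_gt1.
by rewrite [in RHS](divn_eq k (p ^ n.+1)) mulrnDr mulnC mulrnA hx mul0rn add0r.
Qed.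

Lemma zactE n u x : x *+ (p ^ n.+1) = 0 -> zact u x = x *+ u n.
Proof.
have H k m : (k <= m)%N -> x *+ (p ^ k.+1) = 0 -> x *+ u m = x *+ u k.
  by move=> km hx; rewrite (Zp_resE u km) /= mulrn_mod.
rewrite /zact; case: ex_minnP => m /eqP hm _ hn.
by have [mn|/ltnW nm] := leqP m n; [rewrite (H m n) | rewrite (H n m)].
Qed.

Let kill x : exists n, x *+ (p ^ n.+1) = 0.
Proof. by have [n /eqP] := hMb x; exists n. Qed.

Let kill_le x n m : (n <= m)%N -> x *+ (p ^ n.+1) = 0 -> x *+ (p ^ m.+1) = 0.
Proof. by move=> nm hx; rewrite -(subnKC nm) -addSn expnD mulrnA hx mul0rn. Qed.

Lemma zact1 x : zact 1 x = x.
Proof. by have [n hn] := kill x; rewrite (zactE _ hn) mulrn_mod. Qed.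

Lemma zactM u v x : zact (u * v) x = zact u (zact v x).
Proof.
have [n hn] := kill x.
rewrite !(@zactE n) //; last by rewrite mulrnAC hn mul0rn.
by rewrite /= mulrn_mod // mulnC mulrnA.
Qed.

Lemma zactD u x y : zact u (x + y) = zact u x + zact u y.
Proof.
have [n /(kill_le (leq_maxl n _)) hn] := kill x.
have [m /(kill_le (leq_maxr _ m)) hm] := kill y.
by rewrite !(@zactE (maxn n m)) ?mulrnDl ?hn ?hm ?addr0.
Qed.
End ZpAction.

Lemma zact_morph (p : nat) (p_pr : prime p) (M N : zmodType)
    (hM : p_primary p M) (hN : p_primary p N) (f : M -> N) :
  {morph f : x y / x + y} -> forall u x, zact hN u (f x) = f (zact hM u x).
Proof.
move=> fD u x; have f0 : f 0 = 0 by apply: (addrI (f 0)); rewrite -fD !addr0.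
have fn y k : f (y *+ k) = f y *+ k.
  by elim: k => [|k IH]; rewrite ?mulr0n // !mulrS fD IH.
have [n hn] := hM x.
have hn' : x *+ (p ^ n.+1) = 0 by rewrite expnSr mulrnA hn mul0rn.
by rewrite !(@zactE p p_pr _ _ n) ?fn // -fn hn'.
Qed.

(* disc_cont is continuity of the action K x M -> M for the discrete topology
   on M. *)
Record discmod (p : nat) (K : topGroupType) := DiscMod {
  dm_sort :> zmodType;
  dm_primary : p_primary p dm_sort;
  act : K -> dm_sort -> dm_sort;
  act1 : forall x, act 1%g x = x;
  actM : forall g h x, act (g * h)%g x = act g (act h x);
  actD : forall g x y, act g (x + y) = act g x + act g y;
  act_cont : forall x y, open [set g | act g x = y]
}.

Record modhom (p : nat) (K : topGroupType) (M N : discmod p K) := ModHom {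
  mh_fun :> M -> N;
  mhD : forall x y, mh_fun (x + y) = mh_fun x + mh_fun y;
  mh_act : forall g x, mh_fun (act g x) = act g (mh_fun x)
}.

Definition injective_module (p : nat) (K : topGroupType) (I : discmod p K) :=
  forall (M N : discmod p K) (i : modhom M N) (f : modhom M I),
    injective i -> exists g : modhom N I, forall x, g (i x) = f x.

Section BasicModules.
Variables (p : nat) (K : topGroupType).

Lemma mh0 (M N : discmod p K) (f : modhom M N) : f 0 = 0.
Proof. by apply: (addrI (f 0)); rewrite -mhD !addr0. Qed.

Section Trivial.
Variables (A : zmodType) (hA : p_primary p A).
Let tact (g : K) (x : A) := x.
Let tact_cont x y : open [set g | tact g x = y].
Proof.
have [e|ne] := pselect (x = y).
  by rewrite (_ : mkset _ = setT); [exact: openT | by apply/seteqP; split].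
by rewrite (_ : mkset _ = set0); [exact: open0 | by apply/seteqP; split].
Qed.
Definition trivial_module : discmod p K :=
  @DiscMod p K A hA tact (fun=> erefl) (fun _ _ _ => erefl)
    (fun _ _ _ => erefl) tact_cont.
End Trivial.

Lemma zero_primary : p_primary p 'rV[int]_0.
Proof. by move=> x; exists 0%N; exact: thinmx0. Qed.
Definition zero_module : discmod p K := trivial_module zero_primary.

Definition zero_hom (M N : discmod p K) : modhom M N.
Proof.
apply: (@ModHom _ _ M N (fun=> 0)) => [x y|g x]; first by rewrite addr0.
by apply: (addrI (act g (0 : N))); rewrite -actD !addr0.
Defined.

Definition id_hom (M : discmod p K) : modhom M M :=
  @ModHom p K M M id (fun _ _ => erefl) (fun _ _ => erefl).

Definition comp_hom (M N P : discmod p K) (f : modhom N P) (g : modhom M N) :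
  modhom M P.
Proof.
by apply: (@ModHom _ _ M P (fun x => f (g x))) => [x y|k x];
  rewrite ?mhD ?mh_act.
Defined.

End BasicModules.

Record complex (p : nat) (K : topGroupType) := Complex {
  cx_ob :> int -> discmod p K;
  cx_d : forall i, modhom (cx_ob i) (cx_ob (i + 1));
  cx_dd : forall i x, cx_d (i + 1) (cx_d i x) = 0
}.

Record chain_map (p : nat) (K : topGroupType) (C D : complex p K) := ChainMap {
  cm_fun :> forall i, modhom (C i) (D i);
  cm_d : forall i x, cm_fun (i + 1) (cx_d C i x) = cx_d D i (cm_fun i x)
}.

Section Complexes.
Variables (p : nat) (K : topGroupType).
Implicit Types C D E : complex p K.

Definition comp_cm C D E (f : chain_map D E) (g : chain_map C D) :
  chain_map C E.
Proof.
apply: (@ChainMap _ _ C E (fun i => comp_hom (f i) (g i))) => i x /=.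
by rewrite !cm_d.
Defined.

Definition id_cm C : chain_map C C.
Proof.
by apply: (@ChainMap _ _ C C (fun i => id_hom (C i))).
Defined.

(* Every integer has the form i + 1, so all degrees are covered. *)
Definition homotopic C D (f g : chain_map C D) : Prop :=
  exists s : forall i, modhom (C (i + 1)) (D i),
    forall i x,
      f (i + 1) x - g (i + 1) x = cx_d D i (s i x) + s (i + 1) (cx_d C (i + 1) x).

Definition homotopy_equivalence C D (f : chain_map C D) : Prop :=
  exists g : chain_map D C,
    homotopic (comp_cm g f) (id_cm C) /\ homotopic (comp_cm f g) (id_cm D).

(* f induces isomorphisms on the cohomology ker d / im d in every degree. *)
Definition quasi_iso C D (f : chain_map C D) : Prop :=
  forall i,
    (forall x : C (i + 1), cx_d C (i + 1) x = 0 ->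
       (exists y, f (i + 1) x = cx_d D i y) -> exists z, x = cx_d C i z) /\
    (forall y : D (i + 1), cx_d D (i + 1) y = 0 ->
       exists x, cx_d C (i + 1) x = 0 /\
         exists z, y = f (i + 1) x + cx_d D i z).

Definition bounded_below C : Prop :=
  exists n : int, forall i, i < n -> forall x : C i, x = 0.

Definition conc0_ob (M : discmod p K) (i : int) : discmod p K :=
  match i with Posz 0 => M | _ => zero_module p K end.
Definition conc0 (M : discmod p K) : complex p K.
Proof.
by apply: (@Complex p K (conc0_ob M) (fun i => zero_hom _ _)).
Defined.

(* A presentation of the object M of D^+ by a bounded-below complex of
   injectives. *)
Record injective_resolution (M : complex p K) := InjRes {
  res_cx :> complex p K;
  res_map : chain_map M res_cx;
  res_qiso : quasi_iso res_map;
  res_bounded : bounded_below res_cx;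
  res_injective : forall i, injective_module (res_cx i)
}.

End Complexes.

Section Twist.
Variables (p : nat) (p_pr : prime p) (K : topGroupType) (th : character p K).

Section TwistModule.
Variable M : discmod p K.
Let hM := @dm_primary _ _ M.
Let tact (g : K) (x : M) : M := zact hM (th g) (act g x).

Let zact_act g u x : zact hM u (act g x) = act g (zact hM u x).
Proof. exact: (zact_morph p_pr hM hM (actD g)). Qed.
Let tact1 x : tact 1%g x = x.
Proof. by rewrite /tact act1 char1 zact1. Qed.
Let tactM g h x : tact (g * h)%g x = tact g (tact h x).
Proof. by rewrite /tact actM charM zactM // -!zact_act. Qed.
Let tactD g x y : tact g (x + y) = tact g x + tact g y.
Proof. by rewrite /tact actD zactD. Qed.
Let tact_cont x y : open [set g | tact g x = y].
Proof.
rewrite openE => g /= gxy.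
have [n hn] := hM (act g x).
have hn' : act g x *+ (p ^ n.+1) = 0 by rewrite expnSr mulrnA hn mul0rn.
have : nbhs g ([set h | act h x = act g x] `&` [set h | th h n = th g n]).
  apply: filterI; apply: open_nbhs_nbhs; split => //; first exact: act_cont.
  exact: (@char_res_open _ _ th n).
apply: filterS => h /= [hx hth].
by rewrite -gxy /tact hx !(zactE p_pr hM _ hn') hth.
Qed.
Definition twist : discmod p K :=
  @DiscMod p K M hM tact tact1 tactM tactD tact_cont.
End TwistModule.

Definition twist_hom (M N : discmod p K) (f : modhom M N) :
  modhom (twist M) (twist N).
Proof.
apply: (@ModHom _ _ (twist M) (twist N) f); first exact: (@mhD _ _ _ _ f).
move=> g x; rewrite /= -mh_act; apply/esym.
exact: (zact_morph p_pr _ _ (@mhD _ _ _ _ f)).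
Defined.

Definition twist_cx (C : complex p K) : complex p K.
Proof.
apply: (@Complex p K (fun i => twist (C i)) (fun i => twist_hom (cx_d C i))).
by move=> i x; exact: (@cx_dd _ _ C i x).
Defined.

Definition twist_cm (C D : complex p K) (f : chain_map C D) :
  chain_map (twist_cx C) (twist_cx D).
Proof.
apply: (@ChainMap _ _ (twist_cx C) (twist_cx D) (fun i => twist_hom (f i))).
by move=> i x; exact: (@cm_d _ _ _ _ f i x).
Defined.

(* The identity, as a map from M(th) in degree 0 to the degreewise twist of M
   in degree 0. *)
Definition conc0_twist_hom (M : discmod p K) (i : int) :
    modhom (conc0_ob (twist M) i) (twist (conc0_ob M i)) :=
  match i return modhom (conc0_ob (twist M) i) (twist (conc0_ob M i)) with
  | Posz 0 => id_hom (twist M)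
  | _ => zero_hom _ _
  end.
Definition conc0_twist (M : discmod p K) :
  chain_map (conc0 (twist M)) (twist_cx (conc0 M)).
Proof.
apply: (@ChainMap _ _ (conc0 (twist M)) (twist_cx (conc0 M))
  (conc0_twist_hom M)) => i x.
exact: (mh0 (conc0_twist_hom M (i + 1))).
Defined.

End Twist.

Section Invariants.
Variables (p : nat) (K Q : topGroupType) (pi : quotient_map K Q).

Section InvModule.
Variable M : discmod p K.

Definition inv_pred : {pred M} :=
  fun x => `[< forall k, pi k = 1%g -> act k x = x >].

Let act0 k : act k (0 : M) = 0.
Proof. by apply: (addrI (act k (0 : M))); rewrite -actD !addr0. Qed.
Let inv_zmod : zmod_closed inv_pred.
Proof.
split=> [|x y /asboolP hx /asboolP hy]; first by apply/asboolP => k _.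
apply/asboolP => k hk; apply/eqP; rewrite eq_sym subr_eq -{2}(hy k hk) -actD.
by rewrite subrK hx.
Qed.
HB.instance Definition _ := GRing.isZmodClosed.Build M inv_pred inv_zmod.

Record invariant : Type := Invariant { inv_val : M; _ : inv_val \in inv_pred }.
HB.instance Definition _ := [isSub of invariant for inv_val].
HB.instance Definition _ := [Choice of invariant by <:].
HB.instance Definition _ := [SubChoice_isSubZmodule of invariant by <:].

Definition lift (a : Q) : K := projT1 (cid (qm_surj pi a)).
Lemma liftK a : pi (lift a) = a.
Proof. exact: (projT2 (cid (qm_surj pi a))). Qed.

Let pi1 : pi 1%g = 1%g.
Proof. by apply: (mulgI (pi 1%g)); rewrite -qmM !mulg1. Qed.
Let piV k : pi k^-1%g = (pi k)^-1%g.
Proof. by apply: (mulgI (pi k)); rewrite -qmM !mulgV pi1. Qed.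

Lemma invariantP (x : invariant) k h :
  pi k = pi h -> act k (inv_val x) = act h (inv_val x).
Proof.
move=> e; have /asboolP hx := valP x.
rewrite -[k](mulVKg h) actM hx // qmM piV e mulVg //.
Qed.

Let iact_in (a : Q) (x : invariant) : act (lift a) (inv_val x) \in inv_pred.
Proof.
apply/asboolP => k hk; rewrite -actM; apply: invariantP.
by rewrite qmM hk mul1g.
Qed.
Definition inv_act (a : Q) (x : invariant) : invariant :=
  Invariant (iact_in a x).

Lemma inv_actE k x : inv_val (inv_act (pi k) x) = act k (inv_val x).
Proof. by apply: invariantP; rewrite liftK. Qed.

Let primary : p_primary p invariant.
Proof.
move=> x; have [n hn] := @dm_primary _ _ M (inv_val x); exists n.
by apply/val_inj; rewrite raddfMn.
Qed.
Let iact1 x : inv_act 1%g x = x.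
Proof. by apply/val_inj; have := inv_actE 1%g x; rewrite pi1 act1. Qed.
Let iactM a b x : inv_act (a * b)%g x = inv_act a (inv_act b x).
Proof.
rewrite -(liftK a) -(liftK b) -qmM; apply: val_inj.
by rewrite -[val]/(@inv_val) !inv_actE actM.
Qed.
Let iactD a x y : inv_act a (x + y) = inv_act a x + inv_act a y.
Proof. by apply/val_inj; rewrite /= actD. Qed.
Let iact_cont x y : open [set a | inv_act a x = y].
Proof.
apply/(qm_open pi).
rewrite (_ : _ @^-1` _ = [set k | act k (inv_val x) = inv_val y]).
  exact: act_cont.
apply/seteqP; split=> k /=; first by move=> <-; rewrite -inv_actE.
by move=> e; apply: val_inj; exact: etrans (inv_actE k x) e.
Qed.

Definition inv_module : discmod p Q :=
  @DiscMod p Q invariant primary inv_act iact1 iactM iactD iact_cont.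
End InvModule.

Section InvHom.
Variables (M N : discmod p K) (f : modhom M N).
Let f_in (x : invariant M) : f (inv_val x) \in @inv_pred N.
Proof.
by have /asboolP hx := valP x; apply/asboolP => k hk; rewrite -mh_act hx.
Qed.
Definition inv_hom : modhom (inv_module M) (inv_module N).
Proof.
apply: (@ModHom _ _ (inv_module M) (inv_module N)
  (fun x : invariant M => Invariant (f_in x))) => [x y|a x]; apply/val_inj.
  exact: mhD.
exact: mh_act.
Defined.
End InvHom.

Definition inv_cx (C : complex p K) : complex p Q.
Proof.
apply: (@Complex p Q (fun i => inv_module (C i)) (fun i => inv_hom (cx_d C i))).
by move=> i x; apply/val_inj; exact: cx_dd.
Defined.

Definition inv_cm (C D : complex p K) (f : chain_map C D) :
  chain_map (inv_cx C) (inv_cx D).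
Proof.
apply: (@ChainMap _ _ (inv_cx C) (inv_cx D) (fun i => inv_hom (f i))).
by move=> i x; apply/val_inj; exact: cm_d.
Defined.

(* RGamma(ker pi, M), computed on an injective resolution of M; for
   pi = to_trivial K it is RGamma(K, M). *)
Definition RGamma (M : complex p K) (I : injective_resolution M) :
    complex p Q := inv_cx I.

End Invariants.

Lemma inv_trivial_act (p : nat) (K : topGroupType) (M : discmod p K)
    (g : trivial_group) (x : inv_module (to_trivial K) M) : act g x = x.
Proof.
by apply/val_inj; have /asboolP/(_ (lift (to_trivial K) g)) := valP x; apply.
Qed.

(* The identity map of invariants
   ((C^(ker pi)){th})^Q -> (C(th))^K.  *)
Section InvTwist.
Variables (p : nat) (p_pr : prime p) (K Q : topGroupType).
Variables (pi : quotient_map K Q) (th : character p Q).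

Section InvTwistModule.
Variable M : discmod p K.
Let M1 := inv_module (to_trivial Q) (twist p_pr th (inv_module pi M)).
Let M2 :=
  inv_module (to_trivial K) (twist p_pr (char_pullback th pi) M).

Let it_in (x : M1) :
  (inv_val (inv_val x) : M) \in
    inv_pred (to_trivial K) (M := twist p_pr (char_pullback th pi) M).
Proof.
apply/asboolP => k _; have /asboolP/(_ (pi k) erefl) := valP x.
move=> /(congr1 (@inv_val _ _ _ pi M)) e; rewrite -[RHS]e /=.
rewrite -[RHS](@zact_morph p p_pr _ _ _ (@dm_primary _ _ M)
  (@inv_val _ _ _ pi M) (fun _ _ => erefl)).
by rewrite -(inv_actE k).
Qed.
Let it_hom : modhom M1 M2.
Proof.
apply: (@ModHom _ _ M1 M2 (fun x => Invariant (it_in x))) => [x y|g x].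
  by apply/val_inj.
by rewrite !inv_trivial_act.
Defined.
Definition inv_twist_hom := it_hom.
End InvTwistModule.

Definition inv_twist (C : complex p K) :
  chain_map
    (inv_cx (to_trivial Q) (twist_cx p_pr th (inv_cx pi C)))
    (inv_cx (to_trivial K) (twist_cx p_pr (char_pullback th pi) C)).
Proof.
apply: (@ChainMap _ _ (inv_cx (to_trivial Q) (twist_cx p_pr th (inv_cx pi C)))
  (inv_cx (to_trivial K) (twist_cx p_pr (char_pullback th pi) C))
  (fun i => inv_twist_hom (C i))).
by move=> i x; apply/val_inj.
Defined.
End InvTwist.

(* An equivalence in D^+, i.e. in the dg nerve of bounded-below complexes of
   injectives, is a chain homotopy equivalence.  "Canonical" means singled out,
   uniquely up to homotopy, by the property P. *)
Definition canonical_equivalence (p : nat) (K : topGroupType)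
    (C D : complex p K) (P : chain_map C D -> Prop) : Prop :=
  exists phi : chain_map C D,
    [/\ P phi, homotopy_equivalence phi
          & forall phi', P phi' -> homotopic phi' phi].

Section Cyclotomic.
Variables (p : nat) (p_pr : prime p).

Definition piS : quotient_map (GS p) (GammaS p) := quotg_map (HS p).

Definition twistG (th : character p (GammaS p)) : character p (GS p) :=
  char_pullback th piS.

Section TrivialCoefficients.
Variables (A : zmodType) (hA : p_primary p A).

Definition A_G : discmod p (GS p) := trivial_module (GS p) hA.

Definition universal_complex (J : injective_resolution (conc0 A_G)) :
    complex p (GammaS p) := RGamma piS J.

Section Comparison.
Variable th : character p (GammaS p).
Variable I : injective_resolution (conc0 (twist p_pr (twistG th) A_G)).
Variable J : injective_resolution (conc0 A_G).
Variable L : injective_resolution (twist_cx p_pr th (universal_complex J)).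

(* phi is induced by the equality (J(th))^G = ((J^H){th})^Gamma: if f extends
   the identity of A(th) to a map from J(th) to I, then
   phi o f^G is the map induced by the resolution (J^H){th} -> L. *)
Definition twist_comparison
    (phi : chain_map (RGamma (to_trivial (GS p)) I)
                     (RGamma (to_trivial (GammaS p)) L)) : Prop :=
  forall f : chain_map (twist_cx p_pr (twistG th) J) I,
    homotopic
      (comp_cm f (comp_cm (twist_cm p_pr (twistG th) (res_map J))
                          (conc0_twist p_pr (twistG th) A_G)))
      (res_map I) ->
    homotopic
      (comp_cm phi (comp_cm (inv_cm (to_trivial (GS p)) f)
                            (inv_twist p_pr piS th J)))
      (inv_cm (to_trivial (GammaS p)) (res_map L)).
End Comparison.
End TrivialCoefficients.

(* CD_m(M), computed on a resolution of M{m}. *)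
Definition CD (chi : character p (GammaS p)) (m : int)
    (M : complex p (GammaS p))
    (L : injective_resolution (twist_cx p_pr (charX chi m) M)) :
    complex p trivial_group := RGamma (to_trivial (GammaS p)) L.

End Cyclotomic.

(* psi is induced by the identity of M. *)
Definition change_of_resolution (p : nat) (K Q : topGroupType)
    (pi : quotient_map K Q) (M : complex p K) (L L' : injective_resolution M)
    (psi : chain_map (RGamma pi L) (RGamma pi L')) : Prop :=
  forall g : chain_map L L',
    homotopic (comp_cm g (res_map L)) (res_map L') ->
    homotopic psi (inv_cm pi g).

(* Main.v *)
(* J(th) resolves A(th), since twisting is exact and preserves injectives, and
   J^H is a complex of injectives, since inflation is an exact left adjoint of
   (-)^H; the same holds for its twist (J^H){th}.  Hence the comparison
   J(th) -> I and the resolution (J^H){th} -> L are homotopy equivalences, and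
   they remain so after taking G- and Gamma-invariants.  They are joined by the
   isomorphism ((J^H){th})^Gamma = (J(th))^G. *)
From HB Require Import structures.
Require Import Defs.
From mathcomp Require Import all_boot all_order all_algebra all_field.
From mathcomp Require Import all_classical topology_structure product_topology.
From mathcomp Require Import zify.

Set Implicit Arguments.
Unset Strict Implicit.
Unset Printing Implicit Defensive.
Import Order.TTheory GRing.Theory Num.Theory.
Local Open Scope ring_scope.

(** * Dependent choice along the integers *)

Lemma dep_update (I : eqType) (T : I -> Type) (t : forall i, T i) j (c : T j) :
  exists t' : forall i, T i, t' j = c /\ forall i, i != j -> t' i = t i.
Proof.
exists (fun i => if j =P i is ReflectT e then ecast i (T i) e c else t i).
split=> [|i /eqP ij]; case: eqP => [e|//]; first by rewrite eq_axiomK.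
by case: ij.
Qed.

(** Each stage is a family on all the integers with [E] known at indices below [m + k]. The next
    stage changes it at [m + k + 1] only, so the value at every index stabilizes. *)
Lemma int_dep_choice (T : int -> Type) (E : forall i, T i -> T (i + 1) -> Prop)
    (t0 : forall i, T i) (m : int) :
  (forall i, i < m -> E i (t0 i) (t0 (i + 1))) ->
  (forall i a b, E i a b -> exists c, E (i + 1) b c) ->
  exists t : forall i, T i, forall i, E i (t i) (t (i + 1)).
Proof.
move=> t0E stepE.
pose S (k : nat) :=
  {t : forall i, T i | forall i, i < m + k%:Z -> E i (t i) (t (i + 1))}.
have next k (s : S k) :
    {s' : S k.+1 | forall i, i <= m + k%:Z -> sval s' i = sval s i}.
  apply: cid; case: s => s sE /=.
  (* With [m + k] written as [j + 1], the new value [c] lies in [T (j + 1 + 1)] without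
     transport. *)
  have [j jE] : exists j, m + k%:Z = j + 1 by exists (m + k%:Z - 1); lia.
  have [c cE] := stepE j _ _ (sE j ltac:(lia)).
  have [s' [s'c s's]] := dep_update s c.
  suff H i : i < m + k.+1%:Z -> E i (s' i) (s' (i + 1)).
    by exists (exist _ s' H) => i ile; apply: s's; lia.
  move=> ilt; have [{ilt}->|ne] := eqVneq i (j + 1).
    by rewrite s'c s's //; lia.
  by rewrite !s's; [apply: sE| |]; lia.
have s0 : S 0%N by exists t0 => i ilt; apply: t0E; lia.
pose u := nat_rect S s0 (fun k s => sval (next k s)).
have uE k l i : (k <= l)%N -> i <= m + k%:Z -> sval (u l) i = sval (u k) i.
  elim: l => [|l IH]; first by rewrite leqn0 => /eqP->.
  rewrite leq_eqVlt => /orP[/eqP->//|]; rewrite ltnS => kl ile.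
  rewrite -IH //; apply: (svalP (next l (u l))); lia.
(* As [i <= m + |i - m|], the value at [i] is final from stage [|i - m|] on. Stage [K] is late
   enough for both [i] and [i + 1]. *)
exists (fun i => sval (u (absz (i - m)%R)) i) => i.
pose a := absz (i - m)%R; pose b := absz (i + 1 - m)%R; pose K := (a + b).+1%N.
rewrite -(uE a K); [|lia..].
rewrite -(uE b K); [|lia..].
by apply: (svalP (u K)); lia.
Qed.

(** * Discrete modules: images, extension of maps into injectives, direct sums *)

Section Modules.
Variables (p : nat) (K : topGroupType).
Implicit Types M N P I : discmod p K.

Lemma mhN M N (f : modhom M N) x : f (- x) = - f x.
Proof. by apply: (addrI (f x)); rewrite -mhD !subrr mh0. Qed.

Lemma mhB M N (f : modhom M N) x y : f (x - y) = f x - f y.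
Proof. by rewrite mhD mhN. Qed.

Lemma act0 M g : act g (0 : M) = 0.
Proof. by apply: (addrI (act g (0 : M))); rewrite -actD !addr0. Qed.

Lemma actN M g (x : M) : act g (- x) = - act g x.
Proof. by apply: (addrI (act g x)); rewrite -actD !subrr act0. Qed.

Section Image.
Variables (M N : discmod p K) (d : modhom M N).

Definition im_pred : {pred N} := fun y => `[< exists x, d x = y >].

Let im_zmod : zmod_closed im_pred.
Proof.
split=> [|_ _ /asboolP[x <-] /asboolP[y <-]]; apply/asboolP.
  by exists 0; exact: mh0.
by exists (x - y); exact: mhB.
Qed.
HB.instance Definition _ := GRing.isZmodClosed.Build N im_pred im_zmod.

Record im_sort : Type := Image { im_val : N; _ : im_val \in im_pred }.
HB.instance Definition _ := [isSub of im_sort for im_val].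
HB.instance Definition _ := [Choice of im_sort by <:].
HB.instance Definition _ := [SubChoice_isSubZmodule of im_sort by <:].

Let im_act_in g (y : im_sort) : act g (im_val y) \in im_pred.
Proof.
have /asboolP[x xE] := valP y; apply/asboolP; exists (act g x).
by rewrite mh_act xE.
Qed.
Let im_act g (y : im_sort) := Image (im_act_in g y).
Let im_primary : p_primary p im_sort.
Proof.
move=> x; have [n hn] := @dm_primary _ _ N (im_val x); exists n.
by apply/val_inj; rewrite raddfMn.
Qed.
Let im_act1 y : im_act 1%g y = y.
Proof. by apply/val_inj; exact: act1. Qed.
Let im_actM g h y : im_act (g * h)%g y = im_act g (im_act h y).
Proof. by apply/val_inj; exact: actM. Qed.
Let im_actD g x y : im_act g (x + y) = im_act g x + im_act g y.
Proof. by apply/val_inj; exact: actD. Qed.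
Let im_cont x y : open [set g | im_act g x = y]%classic.
Proof.
rewrite (_ : mkset _ = [set g | act g (im_val x) = im_val y]%classic).
  exact: act_cont.
by apply/seteqP; split=> g /= => [<-//|e]; exact: val_inj.
Qed.

(** This stands in for [M / ker d], realized as a submodule of [N]. *)
Definition im_module : discmod p K :=
  @DiscMod p K im_sort im_primary im_act im_act1 im_actM im_actD im_cont.

Definition im_incl : modhom im_module N :=
  @ModHom p K im_module N im_val (fun _ _ => erefl) (fun _ _ => erefl).

Lemma im_incl_inj : injective im_incl.
Proof. exact: val_inj. Qed.

(** Two preimages of [y] differ by an element of [ker d], which [f] kills, so [f] of a chosen
    preimage is additive and equivariant in [y]. *)
Lemma im_factor P (f : modhom M P) : (forall x, d x = 0 -> f x = 0) ->
  exists f' : modhom im_module P, forall x (y : im_module),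
    im_incl y = d x -> f' y = f x.
Proof.
move=> df0; have fE x x' : d x = d x' -> f x = f x'.
  move=> e; apply/eqP; rewrite -subr_eq0 -mhB; apply/eqP/df0.
  by rewrite mhB e subrr.
have ex (y : im_module) : {x | d x = im_val y}.
  by apply: cid; have /asboolP := valP (y : im_sort).
have eD y z : f (sval (ex (y + z))) = f (sval (ex y)) + f (sval (ex z)).
  by rewrite -mhD; apply: fE; rewrite mhD !(svalP (ex _)).
have eA g y : f (sval (ex (act g y))) = act g (f (sval (ex y))).
  by rewrite -mh_act; apply: fE; rewrite mh_act !(svalP (ex _)).
exists (@ModHom p K im_module P (fun y => f (sval (ex y))) eD eA) => x y yx.
by apply: fE; rewrite (svalP (ex y)).
Qed.
End Image.

(** The form of injectivity used in degreewise recursions, where [d] is a differential: [f] factors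
    through the image of [d], and that image injects into [N]. *)
Lemma injective_extend M N I (d : modhom M N) (f : modhom M I) :
  injective_module I -> (forall x, d x = 0 -> f x = 0) ->
  exists g : modhom N I, forall x, g (d x) = f x.
Proof.
move=> injI df0; have [f' f'E] := im_factor df0.
have [g gE] := injI _ _ _ f' (@im_incl_inj _ _ d).
exists g => x; have dx : d x \in im_pred d by apply/asboolP; exists x.
by rewrite -[d x]/(im_incl d (Image dx : im_module d)) gE; apply: f'E.
Qed.

Section DirectSum.
Variables M N : discmod p K.

Let sum_act g (x : M * N) : M * N := (act g x.1, act g x.2).
Let sum_primary : p_primary p (M * N)%type.
Proof.
move=> x; have [n hn] := @dm_primary _ _ M x.1.
have [k hk] := @dm_primary _ _ N x.2; exists (n + k)%N.
rewrite [LHS]surjective_pairing !raddfMn /=.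
by rewrite expnD mulrnA hn mul0rn mulnC mulrnA hk mul0rn.
Qed.
Let sum_act1 x : sum_act 1%g x = x.
Proof. by case: x => x y; rewrite /sum_act !act1. Qed.
Let sum_actM g h x : sum_act (g * h)%g x = sum_act g (sum_act h x).
Proof. by rewrite /sum_act !actM. Qed.
Let sum_actD g x y : sum_act g (x + y) = sum_act g x + sum_act g y.
Proof. by rewrite /sum_act !actD. Qed.
Let sum_cont x y : open [set g | sum_act g x = y]%classic.
Proof.
rewrite (_ : mkset _ =
  [set g | act g x.1 = y.1] `&` [set g | act g x.2 = y.2])%classic.
  by apply: openI; exact: act_cont.
apply/seteqP; split=> g /=; first by move=> <-.
by case: y => y z /= [e e']; rewrite /sum_act e e'.
Qed.

Definition sum_module : discmod p K :=
  @DiscMod p K (M * N)%type sum_primary sum_act sum_act1 sum_actM sum_actD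
    sum_cont.
End DirectSum.

End Modules.

(** * Homotopies, and maps from acyclic complexes to complexes of injectives *)

Section Complexes.
Variables (p : nat) (K : topGroupType).
Implicit Types C D E M : complex p K.

Lemma homotopic_ext C D (f g : chain_map C D) :
  (forall i x, f i x = g i x) -> homotopic f g.
Proof.
move=> fg; exists (fun i => zero_hom _ _) => i x /=.
by rewrite fg subrr mh0 addr0.
Qed.

Section HomLinear.
Variables (M N : discmod p K) (f g : modhom M N).
Let oppD x y : - f (x + y) = - f x + - f y.
Proof. by rewrite mhD opprD. Qed.
Let opp_act h x : - f (act h x) = act h (- f x).
Proof. by rewrite mh_act actN. Qed.
Definition opp_hom : modhom M N :=
  @ModHom p K M N (fun x => - f x) oppD opp_act.

Let addD x y : f (x + y) + g (x + y) = (f x + g x) + (f y + g y).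
Proof. by rewrite !mhD addrACA. Qed.
Let add_act h x : f (act h x) + g (act h x) = act h (f x + g x).
Proof. by rewrite !mh_act actD. Qed.
Definition add_hom : modhom M N :=
  @ModHom p K M N (fun x => f x + g x) addD add_act.
End HomLinear.

Lemma homotopic_sym C D (f g : chain_map C D) : homotopic f g -> homotopic g f.
Proof.
move=> [s sE]; exists (fun i => opp_hom (s i)) => i x /=.
by rewrite -opprB sE opprD mhN.
Qed.

Lemma homotopic_trans C D (f g h : chain_map C D) :
  homotopic f g -> homotopic g h -> homotopic f h.
Proof.
move=> [s sE] [t tE]; exists (fun i => add_hom (s i) (t i)) => i x /=.
by rewrite -(subrKA (g (i + 1) x)) sE tE mhD addrACA.
Qed.

Lemma homotopic_compl C D E (h : chain_map D E) (f g : chain_map C D) :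
  homotopic f g -> homotopic (comp_cm h f) (comp_cm h g).
Proof.
move=> [s sE]; exists (fun i => comp_hom (h i) (s i)) => i x /=.
by rewrite -mhB sE mhD cm_d.
Qed.

Lemma homotopic_compr C D E (f g : chain_map D E) (h : chain_map C D) :
  homotopic f g -> homotopic (comp_cm f h) (comp_cm g h).
Proof.
move=> [s sE]; exists (fun i => comp_hom (s i) (h (i + 1))) => i x /=.
by rewrite sE cm_d.
Qed.

Definition acyclic C : Prop :=
  forall i (x : C (i + 1)), cx_d C (i + 1) x = 0 -> exists z, x = cx_d C i z.

Definition injective_complex C : Prop :=
  bounded_below C /\ forall i, injective_module (C i).

(** The homotopy is built upwards: by acyclicity the kernel of the differential consists of
    boundaries, on which [f - d s] vanishes, so injectivity of [D] yields the next component. *)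
Lemma acyclic_null C D (f : chain_map C D) :
  acyclic C -> injective_complex D ->
  exists s : forall i, modhom (C (i + 1)) (D i),
    forall i x, f (i + 1) x = cx_d D i (s i x) + s (i + 1) (cx_d C (i + 1) x).
Proof.
move=> acC [[n D0] injD].
(* The equation at [i] lives in [D (i + 1)], which is zero for [i < n - 1]; there zero maps solve
   it. *)
apply: (@int_dep_choice (fun i => modhom (C (i + 1)) (D i))
  (fun i s s' => forall x, f (i + 1) x = cx_d D i (s x) + s' (cx_d C (i + 1) x))
  (fun i => zero_hom _ _) (n - 1)).
  by move=> i ilt x /=; rewrite mh0 addr0; apply: D0; lia.
move=> i s s' sE.
pose g := add_hom (f (i + 1 + 1)) (opp_hom (comp_hom (cx_d D (i + 1)) s')).
have [|s'' s''E] := @injective_extend _ _ _ _ _ (cx_d C (i + 1 + 1)) g (injD _).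
  move=> x /acC[z ->] /=; rewrite cm_d sE -mhB addrK.
  exact: cx_dd.
by exists s'' => x; rewrite s''E /= addrCA subrr addr0.
Qed.

(* The recursion for maps to the shift of D; the shift is not formed, as it
   would require transport along i + 1 - 1 = i. *)
Lemma acyclic_shift_null C D (f : forall i, modhom (C i) (D (i + 1))) :
  acyclic C -> injective_complex D ->
  (forall i x, cx_d D (i + 1) (f i x) + f (i + 1) (cx_d C i x) = 0) ->
  exists s : forall i, modhom (C i) (D i),
    forall i x, s (i + 1) (cx_d C i x) = f i x + cx_d D i (s i x).
Proof.
move=> acC [[n D0] injD] fE.
apply: (@int_dep_choice (fun i => modhom (C i) (D i))
  (fun i s s' => forall x, s' (cx_d C i x) = f i x + cx_d D i (s x))
  (fun i => zero_hom _ _) (n - 1)).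
  by move=> i ilt x /=; apply/esym; apply: D0; lia.
move=> i s s' sE.
pose g := add_hom (f (i + 1)) (comp_hom (cx_d D (i + 1)) s').
have [|s'' s''E] := @injective_extend _ _ _ _ _ (cx_d C (i + 1)) g (injD _).
  (* On [x = d z] the equation for [s'] turns [g x] into [f (d z) + d (f z)]. This is 0 by [fE],
     which says that [f] is a chain map to [D[1]], with differential [- d]. *)
  move=> x /acC[z ->] /=; rewrite sE mhD cx_dd addr0.
  by rewrite -[RHS](fE i z) [RHS]addrC.
by exists s'' => x; rewrite s''E.
Qed.

(** * Mapping cones, and extension of maps along quasi-isomorphisms *)

Section Cone.
Variables (C D : complex p K) (q : chain_map C D).

Let cone_ob i := sum_module (C (i + 1)) (D i).
Let cone_d_fun i (x : cone_ob i) : cone_ob (i + 1) :=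
  (- cx_d C (i + 1) x.1, q (i + 1) x.1 + cx_d D i x.2).
Let cone_dD i (x y : cone_ob i) :
  cone_d_fun (x + y) = cone_d_fun x + cone_d_fun y.
Proof.
by congr (_, _); rewrite /= !mhD ?opprD // addrACA.
Qed.
Let cone_d_act i g (x : cone_ob i) :
  cone_d_fun (act g x) = act g (cone_d_fun x).
Proof. by congr (_, _); rewrite /= !mh_act ?actN // -actD. Qed.
Let cone_dd i x : ModHom (@cone_dD (i + 1)) (@cone_d_act (i + 1))
  (ModHom (@cone_dD i) (@cone_d_act i) x) = 0.
Proof.
congr (_, _); rewrite /= !mhN ?mhD ?cx_dd ?opprK //.
by rewrite addr0 cm_d addNr.
Qed.

Definition cone : complex p K :=
  @Complex p K cone_ob (fun i => ModHom (@cone_dD i) (@cone_d_act i)) cone_dd.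

Lemma cone_d_inr i (y : D i) :
  cx_d cone i (0, y) = (0, cx_d D i y) :> cone (i + 1).
Proof. by congr (_, _); rewrite /= !mh0 ?oppr0 ?add0r. Qed.

(** For a cocycle [(x, y)], injectivity of [q] on cohomology gives [x = d z]. Then [q z + y] is a
    cocycle, and surjectivity writes it as [q w + d u]. *)
Lemma cone_acyclic : quasi_iso q -> acyclic cone.
Proof.
move=> qq i [x y] /= [/eqP]; rewrite oppr_eq0 => /eqP dx qxdy.
have [inj _] := qq (i + 1); have [_ surj] := qq i.
have [|z xE] := inj x dx.
  by exists (- y); rewrite mhN; apply/eqP; rewrite -addr_eq0 qxdy.
have [|w [dw [u uE]]] := surj (q (i + 1) z + y).
  by rewrite mhD -cm_d -xE.
exists (w - z, u); congr (_, _) => /=.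
  by rewrite mhB dw sub0r opprK.
by rewrite mhB [RHS]addrAC -uE [X in X - _]addrC addrK.
Qed.

End Cone.

(** The projection of the cone to [C[1]] followed by [f] is null-homotopic, the cone being acyclic.
    The null-homotopy restricts to the chain map [g] on [D], and to a homotopy from [g q] to [f] on
    [C[1]]. *)
Lemma quasi_iso_extend C D M (q : chain_map C D) (f : chain_map C M) :
  quasi_iso q -> injective_complex M ->
  exists g : chain_map D M, homotopic (comp_cm g q) f.
Proof.
move=> qq injM.
have f1D i (x y : cone q i) :
    f (i + 1) (x + y).1 = f (i + 1) x.1 + f (i + 1) y.1 by exact: mhD.
have f1A i g (x : cone q i) : f (i + 1) (act g x).1 = act g (f (i + 1) x.1).
  exact: mh_act.
pose f1 i : modhom (cone q i) (M (i + 1)) := ModHom (@f1D i) (@f1A i).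
have [i x|s sE] := @acyclic_shift_null _ _ f1 (cone_acyclic qq) injM.
  by rewrite /= mhN cm_d addrN.
have hD i (x y : C (i + 1)) :
    s i (x + y, 0) = s i (x, 0) + s i (y, 0).
  by rewrite -mhD; congr (s i (_, _)); rewrite addr0.
have hA i g (x : C (i + 1)) : s i (act g x, 0) = act g (s i (x, 0)).
  by rewrite -mh_act; congr (s i (_, _)); rewrite act0.
have gD i (x y : D i) :
    s i (0, x + y) = s i (0, x) + s i (0, y).
  by rewrite -mhD; congr (s i (_, _)); rewrite addr0.
have gA i g (x : D i) : s i (0, act g x) = act g (s i (0, x)).
  by rewrite -mh_act; congr (s i (_, _)); rewrite act0.
have gd i (x : D i) : s (i + 1) (0, cx_d D i x) = cx_d M i (s i (0, x)).
  by rewrite -cone_d_inr sE /= mh0 add0r.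
exists (@ChainMap _ _ D M (fun i => ModHom (@gD i) (@gA i)) gd).
exists (fun i => ModHom (@hD i) (@hA i)) => i x /=.
(* This splitting expresses [g (q x)] through [sE] at [(x, 0)]. *)
have -> : (0, q (i + 1) x) =
    cx_d (cone q) i (x, 0) + (cx_d C (i + 1) x, 0) :> cone q (i + 1).
  by congr (_, _); rewrite /= ?addNr // addr0 mh0 addr0.
by rewrite mhD sE /= -[X in X - _]addrA [X in X - _]addrC addrK.
Qed.

(** A homotopy [s] from [f q] to [g q] glues with [f - g] to a chain map [F] from the cone to [M]. A
    null-homotopy of [F], restricted to [D], is a homotopy from [f] to [g]. *)
Lemma quasi_iso_unique C D M (q : chain_map C D) (f g : chain_map D M) :
  quasi_iso q -> injective_complex M ->
  homotopic (comp_cm f q) (comp_cm g q) -> homotopic f g.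
Proof.
move=> qq injM [s sE] /=.
pose F_fun i (x : cone q i) : M i := s i x.1 + (f i x.2 - g i x.2).
have FD i (x y : cone q i) : F_fun i (x + y) = F_fun i x + F_fun i y.
  by rewrite /F_fun /= !mhD opprD [RHS]addrACA; congr (_ + _); exact: addrACA.
have FA i h (x : cone q i) : F_fun i (act h x) = act h (F_fun i x).
  by rewrite /F_fun /= !mh_act !actD actN.
have Fd i (x : cone q i) :
    F_fun (i + 1) (cx_d (cone q) i x) = cx_d M i (F_fun i x).
  have /= sEx := sE i x.1.
  rewrite /F_fun /= mhN !mhD opprD mhN !cm_d (addrACA (f _ _)) sEx.
  by rewrite [LHS]addrA (addrC (- _)) addrK.
pose F := @ChainMap _ _ (cone q) M (fun i => ModHom (@FD i) (@FA i)) Fd.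
have [t tE] := acyclic_null F (cone_acyclic qq) injM.
have tD i (x y : D (i + 1)) : t i (0, x + y) = t i (0, x) + t i (0, y).
  by rewrite -mhD; congr (t i (_, _)); rewrite addr0.
have tA i h (x : D (i + 1)) : t i (0, act h x) = act h (t i (0, x)).
  by rewrite -mh_act; congr (t i (_, _)); rewrite act0.
exists (fun i => ModHom (@tD i) (@tA i)) => i x /=.
have := tE i (0, x); rewrite /= /F_fun /= mh0 add0r => ->.
by rewrite -(cone_d_inr q).
Qed.

End Complexes.

(** * Comparison of injective resolutions *)

Section Resolutions.
Variables (p : nat) (K : topGroupType).
Implicit Types C D E M : complex p K.

(** After composition with [r], both [g f] and the identity become [r] up to homotopy, and such an
    extension is unique. *)
Lemma homotopy_inverse_unique C D M (r : chain_map M C) (r' : chain_map M D)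
    (f : chain_map C D) (g : chain_map D C) :
  quasi_iso r -> injective_complex C ->
  homotopic (comp_cm f r) r' -> homotopic (comp_cm g r') r ->
  homotopic (comp_cm g f) (id_cm C).
Proof.
move=> qr injC fr gr'; apply: (quasi_iso_unique qr injC).
apply: homotopic_trans (homotopic_compl g fr) _.
exact: gr'.
Qed.

Lemma quasi_iso_comparison C D M (r : chain_map M C) (r' : chain_map M D) :
  quasi_iso r -> quasi_iso r' -> injective_complex C -> injective_complex D ->
  exists2 f : chain_map C D,
    homotopic (comp_cm f r) r' & homotopy_equivalence f.
Proof.
move=> qr qr' injC injD.
have [f fr] := quasi_iso_extend r' qr injD.
have [g gr'] := quasi_iso_extend r qr' injC.
exists f => //; exists g; split; first exact: homotopy_inverse_unique gr'.
exact: homotopy_inverse_unique fr.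
Qed.

(** Extending the identity of [C] along [q] gives a left inverse [k]. As [q k q] is homotopic to
    [q], uniqueness makes [k] a right inverse too. *)
Lemma quasi_iso_equivalence C D (q : chain_map C D) :
  quasi_iso q -> injective_complex C -> injective_complex D ->
  homotopy_equivalence q.
Proof.
move=> qq injC injD; have [k kq] := quasi_iso_extend (id_cm C) qq injC.
exists k; split=> //; apply: (quasi_iso_unique qq injD).
exact (homotopic_compl q kq).
Qed.

Lemma homotopy_equivalence_comp C D E (f : chain_map D E) (g : chain_map C D) :
  homotopy_equivalence f -> homotopy_equivalence g ->
  homotopy_equivalence (comp_cm f g).
Proof.
move=> [f' [f'f ff']] [g' [g'g gg']]; exists (comp_cm g' f'); split.
  apply: homotopic_trans g'g.
  exact (homotopic_compl g' (homotopic_compr g f'f)).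
apply: homotopic_trans ff'.
exact (homotopic_compl f (homotopic_compr f' gg')).
Qed.

Lemma homotopic_cancelr C D E (e : chain_map C D) (f g : chain_map D E) :
  homotopy_equivalence e -> homotopic (comp_cm f e) (comp_cm g e) ->
  homotopic f g.
Proof.
move=> [e' [_ ee']] fg.
apply: homotopic_trans (homotopic_sym (homotopic_compl f ee')) _.
apply: homotopic_trans (homotopic_compl g ee').
exact (homotopic_compr e' fg).
Qed.

Lemma resolution_injective M (I : injective_resolution M) : injective_complex I.
Proof. by split; [exact: res_bounded | exact: res_injective]. Qed.

(** Serves for [conc0_twist], which is bijective in each degree: cocycles and boundaries are carried
    back along [f]. *)
Lemma quasi_iso_comp_bij C D E (q : chain_map D E) (f : chain_map C D) :
  (forall i, injective (f i)) -> (forall i y, exists x, f i x = y) ->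
  quasi_iso q -> quasi_iso (comp_cm q f).
Proof.
move=> finj fsurj qq i; have [qinj qsurj] := qq i.
have f0 j x : f j x = 0 -> x = 0 by rewrite -(mh0 (f j)) => /finj.
split=> [x dx /qinj[|z fxE]|y /qsurj[x [dx [z ->]]]].
- by rewrite -cm_d dx mh0.
- by have [w wz] := fsurj i z; exists w; apply: finj; rewrite cm_d wz.
have [w wx] := fsurj _ x; exists w; split; last by exists z; rewrite /= wx.
by apply: f0; rewrite cm_d wx.
Qed.

End Resolutions.

(** * Twisting by a character *)

Lemma twist_actE (p : nat) (p_pr : prime p) (K : topGroupType)
    (th : character p K) (M : discmod p K) g (x : M) :
  @act _ _ (twist p_pr th M) g x = zact (@dm_primary _ _ M) (th g) (act g x).
Proof. by []. Qed.

Section TwistResolution.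
Variables (p : nat) (p_pr : prime p) (K : topGroupType) (th : character p K).

(** Twisting keeps the underlying groups and maps, and [quasi_iso] refers only to these. *)
Lemma twist_quasi_iso (C D : complex p K) (q : chain_map C D) :
  quasi_iso q -> quasi_iso (twist_cm p_pr th q).
Proof. by move=> qq i; exact: qq. Qed.

Lemma conc0_twist_inj (M : discmod p K) i : injective (conc0_twist p_pr th M i).
Proof.
have zero_inj (x y : 'rV[int]_0) : x = y by rewrite !thinmx0.
by case: i => [[|n]|n] x y //= _; exact: zero_inj.
Qed.

Lemma conc0_twist_surj (M : discmod p K) i y :
  exists x, conc0_twist p_pr th M i x = y.
Proof.
case: i y => [[|n]|n] y; first by exists y.
  by exists 0; apply/esym; exact: thinmx0.
by exists 0; apply/esym; exact: thinmx0.
Qed.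

(* A map M -> I(th) is a map M(th^-1) -> I. *)
Lemma twist_injective (I : discmod p K) :
  injective_module I -> injective_module (twist p_pr th I).
Proof.
move=> injI M N i f iinj.
pose ti := charX th (-1).
have tK g : th g * ti g = 1 by apply: divrr; exact: char_unit.
have fA g (x : M) : f (@act _ _ (twist p_pr ti M) g x) = @act _ _ I g (f x).
  (* The p-adic scalar [ti g] passes through the additive map [f] and cancels the [th g] in the
     action on the target. *)
  rewrite twist_actE -(zact_morph p_pr _ (@dm_primary _ _ I) (mhD f)) mh_act.
  by rewrite twist_actE -zactM // mulrC tK zact1.
pose f' : modhom (twist p_pr ti M) I :=
  @ModHom p K (twist p_pr ti M) I f (mhD f) fA.
have [g' g'E] := injI _ _ (twist_hom p_pr ti i) f' iinj.
have gA g (x : N) : g' (act g x) = @act _ _ (twist p_pr th I) g (g' x).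
  rewrite twist_actE -mh_act twist_actE.
  rewrite (zact_morph p_pr (@dm_primary _ _ N) (@dm_primary _ _ I) (mhD g')).
  by rewrite -zactM // tK zact1.
by exists (@ModHom p K N (twist p_pr th I) g' (mhD g') gA).
Qed.

Lemma twist_injective_complex (C : complex p K) :
  injective_complex C -> injective_complex (twist_cx p_pr th C).
Proof. by move=> [bC iC]; split=> // i; exact: twist_injective. Qed.

End TwistResolution.

(** * Invariants of injectives and of homotopies *)

Section InvariantComplex.
Variables (p : nat) (K Q : topGroupType) (pi : quotient_map K Q).

Section Inflation.
Variable M : discmod p Q.
Let iact (k : K) (x : M) := act (pi k) x.
Let pi1 : pi 1%g = 1%g.
Proof. by apply: (mulgI (pi 1%g)); rewrite -qmM !mulg1. Qed.
Let iact1 x : iact 1%g x = x. Proof. by rewrite /iact pi1 act1. Qed.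
Let iactM g h x : iact (g * h)%g x = iact g (iact h x).
Proof. by rewrite /iact qmM actM. Qed.
Let iactD g x y : iact g (x + y) = iact g x + iact g y.
Proof. exact: actD. Qed.
Let iact_cont x y : open [set g | iact g x = y]%classic.
Proof. exact: (iffLR (qm_open pi _) (act_cont x y)). Qed.
Definition inflation : discmod p K :=
  @DiscMod p K M (@dm_primary _ _ M) iact iact1 iactM iactD iact_cont.
End Inflation.

(** A map to the invariants of [I] is a map from an inflation to [I], and inflation preserves
    injections. *)
Lemma inv_injective (I : discmod p K) :
  injective_module I -> injective_module (inv_module pi I).
Proof.
move=> injI M N i f iinj.
pose i' : modhom (inflation M) (inflation N) :=
  @ModHom p K (inflation M) (inflation N) i (mhD i) (fun k => mh_act i (pi k)).
have fA k (x : inflation M) : inv_val (f (act k x)) = act k (inv_val (f x)).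
  by rewrite -inv_actE; exact: congr1 (mh_act f (pi k) x).
have fD (x y : inflation M) :
  inv_val (f (x + y)) = inv_val (f x) + inv_val (f y) by rewrite mhD.
have [g gE] := injI _ _ i' (ModHom fD fA) iinj.
(* The kernel of [pi] acts trivially on the inflation of [N], so [g] takes invariant values. *)
have g_in (x : N) : g x \in inv_pred pi (M := I).
  apply/asboolP => k k1; rewrite -mh_act; congr (g _).
  by rewrite -[LHS]/(act (pi k) x) k1 act1.
pose g1 (x : N) : inv_module pi I := Invariant (g_in x).
have g1D x y : g1 (x + y) = g1 x + g1 y by apply/val_inj; exact: (mhD g).
have g1A a x : g1 (act a x) = act a (g1 x).
  have [k <-] := qm_surj pi a; apply/val_inj.
  exact: etrans (mh_act g k x) (esym (inv_actE k (g1 x))).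
by exists (ModHom g1D g1A) => x; apply/val_inj; exact: gE.
Qed.

Lemma inv_injective_complex (C : complex p K) :
  injective_complex C -> injective_complex (inv_cx pi C).
Proof.
move=> [[n C0] iC]; split=> [|i]; last exact: inv_injective.
by exists n => i ilt x; apply/val_inj; exact: C0.
Qed.

Lemma inv_homotopic (C D : complex p K) (f g : chain_map C D) :
  homotopic f g -> homotopic (inv_cm pi f) (inv_cm pi g).
Proof.
move=> [s sE]; exists (fun i => inv_hom pi (s i)) => i x.
by apply/val_inj; exact: sE.
Qed.

Lemma inv_homotopy_equivalence (C D : complex p K) (f : chain_map C D) :
  homotopy_equivalence f -> homotopy_equivalence (inv_cm pi f).
Proof.
move=> [g [gf fg]]; exists (inv_cm pi g); split.
  apply: homotopic_trans (homotopic_trans _ (inv_homotopic gf)) _;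
    by apply: homotopic_ext => i x; apply/val_inj.
apply: homotopic_trans (homotopic_trans _ (inv_homotopic fg)) _;
  by apply: homotopic_ext => i x; apply/val_inj.
Qed.

End InvariantComplex.

(** * The inverse of [inv_twist] *)

Section InvTwistInverse.
Variables (p : nat) (p_pr : prime p) (K Q : topGroupType).
Variables (pi : quotient_map K Q) (th : character p Q).

Section Module.
Variable M : discmod p K.
Let thK := char_pullback th pi.
Let M1 := inv_module (to_trivial Q) (twist p_pr th (inv_module pi M)).
Let M2 := inv_module (to_trivial K) (twist p_pr thK M).

Let inv_in1 (x : M2) : (inv_val x : M) \in inv_pred pi (M := M).
Proof.
(* On the kernel of [pi] the pulled-back character is 1, so there twisted invariance is plain
   invariance. *)
apply/asboolP => k k1; have /asboolP/(_ k erefl) := valP x.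
by rewrite twist_actE /= k1 char1 zact1.
Qed.
Let inv_in2 (x : M2) : (Invariant (inv_in1 x) : twist p_pr th (inv_module pi M))
  \in inv_pred (to_trivial Q) (M := twist p_pr th (inv_module pi M)).
Proof.
apply/asboolP => a _; have [k <-] := qm_surj pi a; apply/val_inj => /=.
have /asboolP/(_ k erefl) := valP x; rewrite twist_actE /= => e.
rewrite -[RHS]e -(inv_actE k (Invariant (inv_in1 x))).
exact/esym/(@zact_morph p p_pr _ _ _ (@dm_primary _ _ M)
  (@inv_val _ _ _ pi M) (fun _ _ => erefl)).
Qed.
Let untwist (x : M2) : M1 := Invariant (inv_in2 x).
Let untwistD x y : untwist (x + y) = untwist x + untwist y.
Proof. by apply/val_inj/val_inj. Qed.
Let untwist_act g x : untwist (act g x) = act g (untwist x).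
Proof. by rewrite !inv_trivial_act. Qed.
Definition inv_untwist_hom : modhom M2 M1 := ModHom untwistD untwist_act.
End Module.

Definition inv_untwist (C : complex p K) :
  chain_map (inv_cx (to_trivial K) (twist_cx p_pr (char_pullback th pi) C))
    (inv_cx (to_trivial Q) (twist_cx p_pr th (inv_cx pi C))).
Proof.
apply: (@ChainMap _ _
  (inv_cx (to_trivial K) (twist_cx p_pr (char_pullback th pi) C))
  (inv_cx (to_trivial Q) (twist_cx p_pr th (inv_cx pi C)))
  (fun i => inv_untwist_hom (C i))).
by move=> i x; apply/val_inj/val_inj.
Defined.

Lemma inv_twist_equivalence (C : complex p K) :
  homotopy_equivalence (inv_twist p_pr pi th C).
Proof.
exists (inv_untwist C); split; apply: homotopic_ext => i x.
  by apply/val_inj/val_inj.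
by apply/val_inj.
Qed.

End InvTwistInverse.

(** * The canonical equivalences *)

Lemma twist_comparison_equivalence (p : nat) (p_pr : prime p) (A : zmodType)
    (hA : p_primary p A) (th : character p (GammaS p))
    (I : injective_resolution (conc0 (twist p_pr (twistG th) (A_G hA))))
    (J : injective_resolution (conc0 (A_G hA)))
    (L : injective_resolution (twist_cx p_pr th (universal_complex J))) :
  canonical_equivalence
    (C := RGamma (to_trivial (GS p)) I)
    (D := RGamma (to_trivial (GammaS p)) L)
    (@twist_comparison p p_pr A hA th I J L).
Proof.
pose r := comp_cm (twist_cm p_pr (twistG th) (res_map J))
                  (conc0_twist p_pr (twistG th) (A_G hA)).
(* With this, [r] exhibits J(th) as an injective resolution of A(th). *)
have qr : quasi_iso r.
  apply: quasi_iso_comp_bij; first exact: conc0_twist_inj.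
    exact: conc0_twist_surj.
  exact: (twist_quasi_iso p_pr _ (@res_qiso _ _ _ J)).
have injJ := resolution_injective J; have injI := resolution_injective I.
have injL := resolution_injective L.
have injJth := twist_injective_complex p_pr (twistG th) injJ.
have [f0 f0r f0E] := quasi_iso_comparison qr (@res_qiso _ _ _ I) injJth injI.
pose e := comp_cm (inv_cm (to_trivial (GS p)) f0) (inv_twist p_pr (piS p) th J).
have eE : homotopy_equivalence e.
  apply: homotopy_equivalence_comp; last exact: inv_twist_equivalence.
  exact: inv_homotopy_equivalence.
(* The source (J^H){th} of [res_map L] already consists of injectives, so the resolution map is a
   homotopy equivalence before taking invariants. *)
have lE : homotopy_equivalence (inv_cm (to_trivial (GammaS p)) (res_map L)).
  apply/inv_homotopy_equivalence/quasi_iso_equivalence => //;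
    first exact: res_qiso.
  by apply: twist_injective_complex; exact: inv_injective_complex.
have [e' [e'e ee']] := eE.
(* The required relation [phi e ~ (res_map L)^Gamma] forces this choice. *)
pose phi := comp_cm (inv_cm (to_trivial (GammaS p)) (res_map L)) e'.
have phiP : twist_comparison (phi : chain_map (RGamma _ I) (RGamma _ L)).
  (* Every [f] extending the identity of A(th) is homotopic to [f0], so it suffices to treat
     [f0]. *)
  move=> f fr; have ff0 : homotopic f f0.
    apply: (quasi_iso_unique qr injI).
    exact: homotopic_trans fr (homotopic_sym f0r).
  have := homotopic_compl phi (homotopic_compr
    (inv_twist p_pr (piS p) th J) (inv_homotopic (to_trivial (GS p)) ff0)).
  move/homotopic_trans; apply.
  exact (homotopic_compl (inv_cm (to_trivial (GammaS p)) (res_map L)) e'e).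
exists phi; split=> //.
  by apply: homotopy_equivalence_comp => //; exists e.
(* The property at [f0] determines [phi' e] up to homotopy, and the equivalence [e] can be
   cancelled. *)
move=> phi' phi'P; apply: (homotopic_cancelr eE).
exact: homotopic_trans (phi'P f0 f0r) (homotopic_sym (phiP f0 f0r)).
Qed.

(** The comparison map between two resolutions is unique up to homotopy, hence so is the map it
    induces on invariants. *)
Lemma change_of_resolution_equivalence (p : nat) (K Q : topGroupType)
    (pi : quotient_map K Q) (M : complex p K) (L L' : injective_resolution M) :
  canonical_equivalence (C := RGamma pi L) (D := RGamma pi L')
    (@change_of_resolution p K Q pi M L L').
Proof.
have injL := resolution_injective L; have injL' := resolution_injective L'.
have [g0 g0r g0E] :=
  quasi_iso_comparison (@res_qiso _ _ _ L) (@res_qiso _ _ _ L') injL injL'.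
exists (inv_cm pi g0); split; last by move=> psi; apply.
  move=> g gr; apply/inv_homotopic/(quasi_iso_unique (@res_qiso _ _ _ L) injL').
  exact: homotopic_trans g0r (homotopic_sym gr).
exact: inv_homotopy_equivalence.
Qed.

Theorem theorem2p8 (p : nat) (p_pr : prime p) (p_odd : odd p)
    (chi : character p (GammaS p)) (chi_cyc : is_cyclotomic chi)
    (A : zmodType) (hA : p_primary p A) :
  (forall (th : character p (GammaS p))
      (I : injective_resolution (conc0 (twist p_pr (twistG th) (A_G hA))))
      (J : injective_resolution (conc0 (A_G hA)))
      (L : injective_resolution (twist_cx p_pr th (universal_complex J))),
    canonical_equivalence
      (C := RGamma (to_trivial (GS p)) I)
      (D := RGamma (to_trivial (GammaS p)) L)
      (@twist_comparison p p_pr A hA th I J L)) /\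
  (forall (m : int)
      (I : injective_resolution
             (conc0 (twist p_pr (twistG (charX chi m)) (A_G hA))))
      (J : injective_resolution (conc0 (A_G hA)))
      (L L' : injective_resolution
             (twist_cx p_pr (charX chi m) (universal_complex J))),
    canonical_equivalence
      (C := RGamma (to_trivial (GS p)) I)
      (D := RGamma (to_trivial (GammaS p)) L)
      (@twist_comparison p p_pr A hA (charX chi m) I J L) /\
    canonical_equivalence
      (C := RGamma (to_trivial (GammaS p)) L)
      (D := CD L')
      (@change_of_resolution p (GammaS p) trivial_group
         (to_trivial (GammaS p))
         (twist_cx p_pr (charX chi m) (universal_complex J)) L L')).
Proof.
split=> [th I J L|m I J L L']; first exact: twist_comparison_equivalence.
split; first exact: twist_comparison_equivalence.
(* [CD L'] is the same derived functor of the same twisted complex, computed on [L'] instead of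
   [L]. *)
exact: change_of_resolution_equivalence.
Qed.
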